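(* Let $F\in\mathcal{A}_1(\mathbb{C}^2)$, $t>0$ and $\mathbf{x}\in\Omega$. Then for every $\alpha\in(0,\frac{\pi}{2})$ the limit $$\Psi_{D,N}(t,\mathbf{x};F)=\lim_{\varepsilon\to0^+}\int_\Omega e^{-\varepsilon|\mathbf{y}|^2}G_{D,N}(t,\mathbf{x},\mathbf{y})F(\mathbf{y})\,d\mathbf{y}$$ exists and equals the absolutely convergent integral $$\Psi_{D,N}(t,\mathbf{x};F)=e^{2i\alpha}\int_0^\infty\int_{-\frac{\pi}{2}}^{\frac{3\pi}{2}}G_{D,N}\big(t,\mathbf{x},\rho e^{i\alpha}(\cos\theta,\sin\theta)\big)\,F\big(\rho e^{i\alpha}(\cos\theta,\sin\theta)\big)\,\rho\,d\theta\,d\rho .$$ (This holds separately for the Dirichlet case $D$ and the Neumann case $N$.)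
   Context: Let $\Gamma=\{(0,x_2):x_2\le0\}\subset\mathbb{R}^2$ and $\Omega=\mathbb{R}^2\setminus\Gamma$. Every $\mathbf{x}\in\Omega$ is written in polar coordinates $\mathbf{x}=r(\cos\varphi,\sin\varphi)$ with $r>0$, $\varphi\in(-\frac{\pi}{2},\frac{3\pi}{2})$. $\mathcal{A}_1(\mathbb{C}^2)$ denotes the space of entire functions $F:\mathbb{C}^2\to\mathbb{C}$ for which there exist $A,B\ge0$ with $|F(\mathbf{z})|\le Ae^{B|\mathbf{z}|}$ for all $\mathbf{z}\in\mathbb{C}^2$; here $|\mathbf{z}|=\sqrt{|z_1|^2+|z_2|^2}$. Let $\Lambda(z)=\frac{2}{\sqrt{\pi}}\int_0^\infty e^{-s^2-2zs}ds$ for $z\in\mathbb{C}$ (an entire function). For $t>0$, $\mathbf{x}=r(\cos\varphi,\sin\varphi)\in\Omega$, $w\in\mathbb{C}$ with $\Re w>0$ and $\theta\in(-\frac{\pi}{2},\frac{3\pi}{2})$, define $$G_{D,N}\big(t,\mathbf{x},w(\cos\theta,\sin\theta)\big)=\frac{e^{-\frac{(r+w)^2}{4it}}}{8i\pi t}\Big(\Lambda\Big(\tfrac{\sqrt{rw}\cos(\frac{\varphi-\theta}{2})}{\sqrt{it}}\Big)\mp\Lambda\Big(-\tfrac{\sqrt{rw}\sin(\frac{\varphi+\theta}{2})}{\sqrt{it}}\Big)\Big),$$ with principal square roots, the sign $-$ for $G_D$ (Dirichlet) and $+$ for $G_N$ (Neumann). For real $w=\rho>0$ this is the Green's function of the time-dependent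 Schrödinger equation $i\partial_t\Psi=-\Delta\Psi$ on $\Omega$ with Dirichlet ($\Psi=0$) resp. Neumann ($\partial_{x_1}\Psi=0$) boundary condition on $\Gamma$, evaluated at $\mathbf{y}=\rho(\cos\theta,\sin\theta)\in\Omega$. *)

(* Defs.v *)
From mathcomp Require Import all_boot all_order all_algebra.
From mathcomp Require Import all_classical all_reals all_analysis.
From mathcomp Require Export complex.
Import Order.TTheory GRing.Theory Num.Theory.

Set Implicit Arguments.
Unset Strict Implicit.
Unset Printing Implicit Defensive.

Local Open Scope ring_scope.
Local Open Scope classical_set_scope.
Local Open Scope complex_scope.

Section Defs.
Variable R : realType.

Definition cabs (z : R[i]) : R := Num.sqrt (complex.Re z ^+ 2 + complex.Im z ^+ 2).

Definition cabs2 (z : R[i] * R[i]) : R :=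
  Num.sqrt (cabs z.1 ^+ 2 + cabs z.2 ^+ 2).

Definition cexp (z : R[i]) : R[i] :=
  (expR (complex.Re z) * cos (complex.Im z)) +i* (expR (complex.Re z) * sin (complex.Im z)).

(* sqrtc (mathcomp-real-closed) is the principal square root:
   complex.Re (sqrtc z) >= 0, and complex.Im (sqrtc z) >= 0 when complex.Re (sqrtc z) = 0. *)
Definition csqrt (z : R[i]) : R[i] := sqrtc z.

Definition cintegrable d (T : measurableType d) (mu : {measure set T -> \bar R})
    (D : set T) (f : T -> R[i]) : Prop :=
  mu.-integrable D (EFin \o (fun y => complex.Re (f y))) /\
  mu.-integrable D (EFin \o (fun y => complex.Im (f y))).

Definition cintegral d (T : measurableType d) (mu : {measure set T -> \bar R})
    (D : set T) (f : T -> R[i]) : R[i] :=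
  (Rintegral mu D (fun y => complex.Re (f y))) +i* (Rintegral mu D (fun y => complex.Im (f y))).

Definition leb2 := (@lebesgue_measure R \x @lebesgue_measure R)%E.

Definition entire2 (F : R[i] * R[i] -> R[i]) : Prop :=
  forall z : R[i] * R[i], exists a b : R[i],
    forall e : R, 0 < e -> exists2 d : R, 0 < d &
      forall h : R[i] * R[i], cabs2 h < d ->
        cabs (F (z.1 + h.1, z.2 + h.2) - F z - a * h.1 - b * h.2)
          <= e * cabs2 h.

Definition A1 (F : R[i] * R[i] -> R[i]) : Prop :=
  entire2 F /\
  exists A B : R, [/\ 0 <= A, 0 <= B &
    forall z, cabs (F z) <= A * expR (B * cabs2 z)].

Definition Lambda (z : R[i]) : R[i] :=
  (2 / Num.sqrt pi)%:C *
  cintegral (@lebesgue_measure R) [set s | 0 <= s]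
    (fun s => cexp (- (s ^+ 2)%:C - 2%:R * z * s%:C)).

Inductive BC := Dirichlet | Neumann.

Definition bc_sign (bc : BC) : R[i] :=
  match bc with Dirichlet => -1 | Neumann => 1 end.

(* G_{D,N}(t, r(cos phi, sin phi), w(cos theta, sin theta)) *)
Definition Gfun (bc : BC) (t r phi : R) (w : R[i]) (theta : R) : R[i] :=
  cexp (- (r%:C + w) ^+ 2 / (4%:R * 'i * t%:C)) / (8%:R * 'i * pi%:C * t%:C) *
  (Lambda (csqrt (r%:C * w) * (cos ((phi - theta) / 2))%:C / csqrt ('i * t%:C))
   + bc_sign bc *
     Lambda (- (csqrt (r%:C * w) * (sin ((phi + theta) / 2))%:C) / csqrt ('i * t%:C))).

Definition Omega : set (R * R) := [set y | ~ (y.1 = 0 /\ y.2 <= 0)].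

Definition prad (y : R * R) : R := Num.sqrt (y.1 ^+ 2 + y.2 ^+ 2).

Definition pangle (y : R * R) : R :=
  xget 0 [set phi | -(pi / 2) < phi < 3%:R * pi / 2 /\
                    y = (prad y * cos phi, prad y * sin phi)].

Definition G (bc : BC) (t : R) (x y : R * R) : R[i] :=
  Gfun bc t (prad x) (pangle x) (prad y)%:C (pangle y).

Definition reg_integrand (bc : BC) (F : R[i] * R[i] -> R[i]) (t : R) (x : R * R)
    (eps : R) (y : R * R) : R[i] :=
  (expR (- eps * prad y ^+ 2))%:C * G bc t x y * F (y.1%:C, y.2%:C).

Definition rot_integrand (bc : BC) (F : R[i] * R[i] -> R[i]) (t : R) (x : R * R)
    (alpha : R) (p : R * R) : R[i] :=
  let w := p.1%:C * cexp (alpha *i) in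
  Gfun bc t (prad x) (pangle x) w p.2 *
  F (w * (cos p.2)%:C, w * (sin p.2)%:C) * p.1%:C.

Definition rot_domain : set (R * R) :=
  [set p | 0 < p.1 /\ -(pi / 2) < p.2 < 3%:R * pi / 2].

End Defs.

(* Main.v *)
From HB Require Import structures.
Require Import Defs.
From mathcomp Require Import all_boot all_order all_algebra.
From mathcomp Require Import all_classical all_reals all_analysis.
From mathcomp Require Import complex.
From mathcomp Require Import measurable_realfun ring lra.
Import Order.TTheory GRing.Theory Num.Theory.
Import numFieldNormedType.Exports.
Set Implicit Arguments.
Unset Strict Implicit.
Unset Printing Implicit Defensive.
Local Open Scope ring_scope.
Local Open Scope classical_set_scope.

(* In the square-root variable v, with v^2 = w, the integrand is entire: Lambda is
   entire, and Cauchy's theorem on rectangles (Goursat's bisection) needs only the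
   pointwise complex differentiability assumed of F. Polar coordinates turn the
   regularized integral over Omega into radial integrals over real w. In the variable
   log w the sector 0 <= arg w <= alpha becomes a strip, on which the integrand is
   O(exp(- |Re log w|)): its Gaussian exponent - eps Re (w^2) - Im (w^2) / (4 t) is
   negative throughout the sector once it is so on the two bounding rays. So each
   radial contour can be rotated by alpha, where the integrand decays like a Gaussian
   even for eps = 0, uniformly in small eps, and the limit eps -> 0 is taken there. *)

(** * Change of variables and polar coordinates *)

(** The variable v is forced by [csqrt (r w)] in the kernel: this root has a branch cut in w,
    whereas sqrt(r) v has none, and the two agree as long as Re v > 0, which covers all arguments of
    w in [0, pi/2]. The prefactor e^{2 i alpha} is that of w dw on the rotated ray; with z = log w
    it becomes part of the entire factor e^{2z}, which also supplies the decay as Re z -> -oo, the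
    Gaussian acting only as Re z -> +oo. On the rotated ray the decay rate is eps cos(2 alpha) +
    sin(2 alpha) / (4 t). For alpha > pi/4 the cosine is negative and a large eps destroys the
    decay, so the rotation is made for small eps only, which is all that the limit sees; there the
    integrals differ from their limit by O(eps). A separate obstacle is measurability over Omega:
    [pangle] is defined by choice, so an explicit half-angle formula takes its place before polar
    coordinates are introduced. *)

Section density.
Local Open Scope ereal_scope.
Context d (T : measurableType d) (R : realType).
Variables (mu : {measure set T -> \bar R}) (phi : T -> R).

(* The two proofs are arguments so that the measure instance can be inferred. *)
Definition density (_ : measurable_fun setT phi) (_ : forall x, (0 <= phi x)%R)
  (A : set T) : \bar R := \int[mu]_(x in A) (phi x)%:E.

Hypotheses (mphi : measurable_fun setT phi) (phi0 : forall x, (0 <= phi x)%R).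
Local Notation nu := (density mphi phi0).

Let density0 : nu set0 = 0. Proof. exact: integral_set0. Qed.

Let density_ge0 A : 0 <= nu A.
Proof. by apply: integral_ge0 => x _; rewrite lee_fin. Qed.

Let density_sigma_additive : semi_sigma_additive nu.
Proof.
move=> A mA tA mUA; rewrite /density ge0_integral_bigcup//=; last 2 first.
- by apply/measurable_EFinP/measurable_funTS.
- by move=> x _; rewrite lee_fin.
by apply: is_cvg_ereal_nneg_natsum_cond => n _ _; exact: density_ge0.
Qed.

HB.instance Definition _ := isMeasure.Build _ _ _
  nu density0 density_ge0 density_sigma_additive.

Import HBNNSimple.

(** By monotone convergence it suffices to treat simple functions, and for an indicator the equality
    is the definition of the density measure. *)
Lemma ge0_integral_density (f : T -> \bar R) :
  measurable_fun setT f -> (forall x, 0 <= f x) ->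
  \int[nu]_x f x = \int[mu]_x (f x * (phi x)%:E).
Proof.
move=> mf f0; pose h := nnsfun_approx measurableT mf.
have -> : \int[nu]_x f x = lim (\int[nu]_x (EFin \o h n) x @[n --> \oo]).
  have fE x : f x = lim ((EFin \o h n) x @[n --> \oo]).
    by apply/esym/cvg_lim => //; exact: cvg_nnsfun_approx.
  under eq_integral => x _ do rewrite fE.
  apply: monotone_convergence => //.
  - by move=> n; apply/measurable_EFinP; exact/measurable_funP.
  - by move=> n x _ //=; rewrite lee_fin.
  - by move=> x _ a b ab; rewrite lee_fin; exact/lefP/nd_nnsfun_approx.
have -> : \int[mu]_x (f x * (phi x)%:E) =
    lim (\int[mu]_x ((EFin \o h n) x * (phi x)%:E) @[n --> \oo]).
  have fg x : f x * (phi x)%:E = lim ((EFin \o h n) x * (phi x)%:E @[n --> \oo]).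
    by apply/esym/cvg_lim => //; apply: cvgeZr => //; exact: cvg_nnsfun_approx.
  under eq_integral => x _ do rewrite fg.
  apply: monotone_convergence => [//| | |].
  - by move=> n; apply/emeasurable_funM; exact/measurable_EFinP.
  - by move=> n x _ /=; rewrite mule_ge0 ?lee_fin.
  - move=> x _ a b ab/=; rewrite lee_wpmul2r ?lee_fin//.
    exact/lefP/nd_nnsfun_approx.
suff suf n : \int[nu]_x (EFin \o h n) x = \int[mu]_x ((EFin \o h n) x * (phi x)%:E).
  by under eq_fun do rewrite suf.
rewrite integralT_nnsfun sintegralE.
transitivity (\int[mu]_x
    (\sum_(y \in range (h n)) y%:E * ((\1_(h n @^-1` [set y]) x)%:E * (phi x)%:E))); last first.
  apply: eq_integral => t _; rewrite /= [in RHS]fimfunE -fsumEFin//.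
  rewrite ge0_mule_fsuml//; last first.
    by move=> y; exact: nnfun_muleindic_ge0.
  by apply: eq_fsbigr => y _; rewrite muleA -EFinM.
have mI y : measurable_fun setT (fun x => (\1_(h n @^-1` [set y]) x)%:E * (phi x)%:E).
  by apply: emeasurable_funM; apply/measurable_EFinP.
rewrite ge0_integral_fsum//; last 2 first.
- by move=> y; apply: emeasurable_funM => //.
- move=> y x _; rewrite muleA; apply: mule_ge0; last by rewrite lee_fin.
  exact: nnfun_muleindic_ge0.
apply: eq_fsbigr => y; rewrite inE => -[z _ <-].
rewrite ge0_integralZl//; last 2 first.
- by move=> x _; rewrite mule_ge0 ?lee_fin.
- by rewrite lee_fin.
congr (_ * _); rewrite /= /density integral_mkcond; apply: eq_integral => x _.
rewrite patchE indicE; case: ifPn => _; last by rewrite mul0e.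
by rewrite mul1e.
Qed.

End density.

Section change_of_variables.
Context {R : realType}.
Notation mu := (@lebesgue_measure R).
Variables (phi dphi psi : R -> R) (I : set R).
Hypothesis mI : measurable I.
Hypothesis mpsi : measurable_fun setT psi.
Hypothesis phi_lt : {homo phi : x y / x < y}.
Hypothesis phiI : forall u, I (phi u).
Hypothesis phiK : cancel phi psi.
Hypothesis psiK : forall x, I x -> phi (psi x) = x.
Hypothesis itvI : forall c d, `]phi c, phi d] `<=` I.
Hypothesis phi_deriv : forall u, is_derive u (1 : R) phi (dphi u).
Hypothesis cdphi : continuous dphi.
Hypothesis dphi0 : forall u, 0 <= dphi u.

Let cphi : continuous phi.
Proof.
by move=> x; apply/differentiable_continuous/derivable1_diffP.
Qed.

Let mdphi : measurable_fun setT dphi.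
Proof. exact: continuous_measurable_fun. Qed.

Let mphi : measurable_fun setT phi.
Proof. exact: continuous_measurable_fun. Qed.

Let mindic : measurable_fun setT (\1_I : R -> R).
Proof. exact: measurable_indic. Qed.

Let indic0 x : 0 <= \1_I x :> R. Proof. by rewrite indicE. Qed.

Let muI := density mu mindic indic0.
Let m1 := pushforward muI (psi : R -> measurableTypeR R).
Let m2 := density mu mdphi dphi0.

Let phi_le c d : (phi c <= phi d) = (c <= d).
Proof. exact: (le_mono phi_lt). Qed.

Let phi_ltE c d : (phi c < phi d) = (c < d).
Proof. by rewrite !ltNge phi_le. Qed.

Let m12_itv (c d : R) : m1 `]c, d] = m2 `]c, d].
Proof.
have [cd|dc] := ltP c d; last first.
  rewrite set_itv_ge -?leNgt ?bnd_simp// /m1 /m2 /pushforward preimage_set0.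
  by rewrite /muI /density !integral_set0.
have -> : m1 `]c, d] = mu `]phi c, phi d].
  rewrite /m1 /pushforward /muI /density integral_indic//; last first.
    by rewrite -[X in measurable X]setTI; exact: mpsi.
  congr (mu _); apply/seteqP; split.
    move=> x [] /= Ix; rewrite !in_itv/=.
    by move: (psiK Ix); move: (psi x) => y <-; rewrite phi_ltE phi_le.
  move=> x /= xcd; have Ix := itvI xcd; split => //.
  move: xcd; rewrite /= !in_itv/=.
  by move: (psiK Ix); move: (psi x) => y <-; rewrite phi_ltE phi_le.
rewrite lebesgue_measure_itv/= lte_fin phi_lt//.
rewrite /m2 /density integral_itv_obnd_cbnd; last first.
  exact/measurable_EFinP/measurable_funTS.
rewrite (@continuous_FTC2 _ dphi phi)//.
- exact: continuous_subspaceT.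
- split.
  + by move=> x _; apply: ex_derive.
  + by apply: cvg_at_right_filter; exact: cphi.
  + by apply: cvg_at_left_filter; exact: cphi.
- by move=> x _; rewrite derive1E; apply: derive_val.
Qed.

Let m2_lty (a b : R) : (m2 `]a, b] < +oo)%E.
Proof.
have le1 : (m2 `]a, b] <= \int[mu]_(x in `[a, b]) (dphi x)%:E)%E.
  apply: ge0_subset_integral => //.
  - exact/measurable_EFinP/measurable_funTS.
  - by move=> x _; rewrite lee_fin.
  - exact: subset_itv_oc_cc.
apply: le_lt_trans le1 _.
have := @continuous_compact_integrable _ dphi `[a, b] (@segment_compact _ _ _)
  (continuous_subspaceT cdphi).
move=> /integrableP[_].
by under eq_integral do rewrite gee0_abs ?lee_fin//.
Qed.

Let m12 A : measurable A -> m1 A = m2 A.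
Proof.
move=> mA.
apply: (@measure_unique _ R (measurableTypeR R) (@ocitv R)
  (fun n => `]- n%:R, n%:R]%classic)) => //=.
- exact: ocitvI.
- by move=> n; exists (- n%:R, n%:R).
- apply/seteqP; split=> // x _; exists (Num.bound `|x|) => //=.
  have /ltW := archi_boundP (normr_ge0 x).
  have := archi_boundP (normr_ge0 x).
  by rewrite in_itv/= ltr_norml ler_norml => /andP[-> _] /andP[_ ->].
- by move=> _ [[c d] _ <-] /=; exact: m12_itv.
- move=> n; rewrite [X in (X < _)%E]m12_itv.
  exact: m2_lty.
Qed.

(** The image under [psi] of Lebesgue measure on I and the measure of density [dphi] agree on
    half-open intervals by the fundamental theorem of calculus, hence on all Borel sets. Integrands
    that are merely measurable are thereby covered, as Fubini requires below. *)
Lemma ge0_integral_change_of_variables (f : R -> \bar R) :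
  measurable_fun setT f -> (forall x, 0 <= f x)%E ->
  (\int[mu]_(x in I) f x = \int[mu]_u (f (phi u) * (dphi u)%:E))%E.
Proof.
move=> mf f0.
have mfphi : measurable_fun setT (f \o phi) by exact: measurableT_comp.
rewrite -(@ge0_integral_density _ _ _ mu _ mdphi dphi0 (f \o phi))//.
transitivity (\int[m1]_u (f \o phi) u)%E; last first.
  by apply: eq_measure_integral => A mA _; exact: m12.
rewrite ge0_integral_pushforward//= ge0_integral_density//=; first last.
- exact: (measurableT_comp mfphi mpsi).
- rewrite integral_mkcond; apply: eq_integral => x _.
  rewrite patchE indicE /=; case: ifPn => xI; last by rewrite mule0.
  by rewrite mule1 psiK//; exact/set_mem.
- by move=> x; exact: f0.
Qed.

End change_of_variables.

Section substitutions.
Context {R : realType}.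
Notation mu := (@lebesgue_measure R).
Local Open Scope ereal_scope.

Lemma ge0_integral_scale (a : R) (f : R -> \bar R) : (0 < a)%R ->
  measurable_fun setT f -> (forall x, 0 <= f x) ->
  \int[mu]_x f x = \int[mu]_u (f (a * u)%R * a%:E).
Proof.
move=> a0 mf f0; have a_neq0 : a != 0%R by rewrite gt_eqF.
apply: (@ge0_integral_change_of_variables R (fun u => a * u)%R (cst a) (fun x => a^-1 * x)%R) => //.
- exact: measurable_funM.
- by move=> x y xy /=; rewrite ltr_pM2l.
- by move=> x _; rewrite mulVKf.
- by move=> u; apply: is_derive_eq; exact: mulr1.
- by move=> u; exact: cvg_cst.
- by move=> u; exact: ltW.
Qed.

Lemma ge0_integral_shift (a : R) (f : R -> \bar R) :
  measurable_fun setT f -> (forall x, 0 <= f x) ->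
  \int[mu]_x f x = \int[mu]_u f (u + a)%R.
Proof.
move=> mf f0.
transitivity (\int[mu]_u (f (u + a)%R * (cst 1%R u)%:E)); last first.
  by apply: eq_integral => x _; rewrite mule1.
apply: (@ge0_integral_change_of_variables R (fun u => u + a)%R (cst 1%R)
  (fun x => x - a)%R setT) => //.
- exact: measurable_funD.
- by move=> x y xy; rewrite ltrD2r.
- by move=> x _; rewrite subrK.
- by move=> u; apply: is_derive_eq; rewrite addr0.
- by move=> u; exact: cvg_cst.
Qed.

Lemma ge0_integral_exp (f : R -> \bar R) :
  measurable_fun setT f -> (forall x, 0 <= f x) ->
  \int[mu]_(x in `]0%R, +oo[) f x = \int[mu]_u (f (expR u) * (expR u)%:E).
Proof.
move=> mf f0.
apply: (@ge0_integral_change_of_variables R expR expR (@ln R)) => //.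
- by move=> x y; rewrite ltr_expR.
- by move=> x; rewrite /= in_itv/= andbT => x0; rewrite lnK// posrE.
- move=> c d x /=; rewrite !in_itv/= andbT => /andP[+ _].
  by apply: lt_trans; exact: expR_gt0.
- exact: continuous_expR.
Qed.

Lemma ge0_integral_atan (f : R -> \bar R) :
  measurable_fun setT f -> (forall x, 0 <= f x) ->
  \int[mu]_(x in `](- (pi / 2))%R, (pi / 2)%R[) f x =
  \int[mu]_u (f (atan u) * ((1 + u ^+ 2)^-1)%:E).
Proof.
move=> mf f0.
(* The inverse has to be measurable on the whole line, so [tan] is cut off to 0 outside the interval
   where it is continuous. *)
apply: (@ge0_integral_change_of_variables R (@atan R) (fun u => (1 + u ^+ 2)^-1)%R
  (@tan R \_ `](- (pi / 2))%R, (pi / 2)%R[)) => //.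
- apply/(measurable_restrictT _ _).1 => //.
  apply: open_continuous_measurable_fun => // x.
  by rewrite inE/= in_itv/= => /cos_gt0_pihalf/gt_eqF/negbT/continuous_tan.
- exact: lt_atan.
- by move=> x xI; rewrite patchE ifT ?inE//; exact: tanK.
- move=> c d x /=; rewrite !in_itv/= => /andP[cx xd].
  by rewrite (lt_trans _ cx) ?atan_gtNpi2// (le_lt_trans xd)// atan_ltpi2.
- move=> u; apply: cvgV; first by rewrite gt_eqF// ltr_wpDr// sqr_ge0.
  by apply: cvgD; [exact: cvg_cst|exact: exprn_continuous].
- by move=> u; rewrite invr_ge0 addr_ge0// sqr_ge0.
Qed.

End substitutions.

Section polar.
Context {R : realType}.
Notation mu := (@lebesgue_measure R).
Local Open Scope ereal_scope.

Lemma ge0_integral_oppr (f : R -> \bar R) :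
  measurable_fun setT f -> (forall x, 0 <= f x) ->
  \int[mu]_(x in `]-oo, 0%R[) f x = \int[mu]_(x in `]0%R, +oo[) f (- x)%R.
Proof.
move=> mf f0; have mfN : measurable_fun setT (fun x : R => f (- x)%R).
  by apply: measurableT_comp.
rewrite integral_itv_bndo_bndc; last exact: measurable_funTS.
rewrite integral_itv_obnd_cbnd; last exact: measurable_funTS.
rewrite (@ge0_integration_by_substitution0 R (fun x => f (- x)%R))//.
by apply: eq_integral => x _; rewrite opprK.
Qed.

Lemma integral_split0 (f : R -> \bar R) :
  measurable_fun setT f -> (forall x, 0 <= f x) ->
  \int[mu]_x f x =
  \int[mu]_(x in `]-oo, 0%R[) f x + \int[mu]_(x in `]0%R, +oo[) f x.
Proof.
move=> mf f0; rewrite -{1}(setUv `]-oo, (0%R : R)[%classic) setCitvl.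
rewrite ge0_integral_setU//=; last 2 first.
- exact: measurable_funTS.
- by rewrite -setCitvl; exact/disj_setPCl.
by rewrite integral_itv_obnd_cbnd//; exact: measurable_funTS.
Qed.

Lemma ge0_integral_opprT (f : R -> \bar R) :
  measurable_fun setT f -> (forall x, 0 <= f x) ->
  \int[mu]_x f x = \int[mu]_x f (- x)%R.
Proof.
move=> mf f0; have mfN : measurable_fun setT (fun x : R => f (- x)%R).
  by apply: measurableT_comp.
rewrite !integral_split0// ge0_integral_oppr// (ge0_integral_oppr mfN)//.
by under [X in _ = X + _]eq_integral do rewrite opprK; rewrite addeC.
Qed.

Lemma measurable_comp_pair d (T : measurableType d) (f g : T -> R) (h : R * R -> \bar R) :
  measurable_fun setT f -> measurable_fun setT g -> measurable_fun setT h ->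
  measurable_fun setT (fun x => h (f x, g x)).
Proof.
move=> mf mg mh; apply: (measurableT_comp mh); exact: measurable_fun_pair.
Qed.

Let pos : set R := `]0%R, +oo[%classic.
Let mpos : measurable pos. Proof. exact: measurable_itv. Qed.

Let polK (g : R * R -> \bar R) (q : R) :=
  \int[mu]_(r in pos) (g (r * cos q, r * sin q)%R * r%:E).

Let polK_ge0 g q : (forall y, 0 <= g y) -> 0 <= polK g q.
Proof.
move=> g0; apply: integral_ge0 => r; rewrite /pos/= in_itv/= andbT => /ltW r0.
by rewrite mule_ge0// lee_fin.
Qed.

Let measurable_polK (g : R * R -> \bar R) :
  measurable_fun setT g -> (forall y, 0 <= g y) -> measurable_fun setT (polK g).
Proof.
move=> mg g0.
have mk2 : measurable_fun setT (fun z : R * R =>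
    g (z.1 * cos z.2, z.1 * sin z.2)%R * (z.1 * \1_pos z.1)%:E).
  have mc : measurable_fun setT (@cos R) by apply: continuous_measurable_fun => x; exact: continuous_cos.
  have ms : measurable_fun setT (@sin R) by apply: continuous_measurable_fun => x; exact: continuous_sin.
  apply: emeasurable_funM.
    apply: measurable_comp_pair => //; apply: measurable_funM; try exact: measurable_fst;
    by apply: measurableT_comp => //; exact: measurable_snd.
  apply/measurable_EFinP/measurable_funM; first exact: measurable_fst.
  by apply: measurableT_comp; [exact: measurable_indic|exact: measurable_fst].
have k20 (z : R * R) : 0 <= g (z.1 * cos z.2, z.1 * sin z.2)%R * (z.1 * \1_pos z.1)%:E.
  rewrite indicE; case: (boolP (z.1 \in pos)) => [|_]; last by rewrite mulr0 mule0.
  rewrite inE/pos/= in_itv/= andbT => /ltW z0.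
  by rewrite mulr1 mule_ge0// lee_fin.
rewrite (_ : polK g = fun q =>
  \int[mu]_r (g (r * cos q, r * sin q)%R * (r * \1_pos r)%:E)).
  exact: (@measurable_fun_fubini_tonelli_G _ _ _ _ _ mu _ mk2 k20).
apply/funext => q; rewrite /polK integral_mkcond; apply: eq_integral => r _.
by rewrite patchE indicE; case: ifPn; rewrite ?mulr1// mulr0 mule0.
Qed.

(** For fixed a > 0 substitute b = a s and exchange the integrals; then s = tan q and a = r cos q
    turn a da ds into r dr dq. *)
Let half_plane (g : R * R -> \bar R) :
  measurable_fun setT g -> (forall y, 0 <= g y) ->
  \int[mu]_(a in `]0%R, +oo[) \int[mu]_b g (a, b) =
  \int[mu]_(q in `](- (pi / 2))%R, (pi / 2)%R[) polK g q.
Proof.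
move=> mg g0.
transitivity (\int[mu]_a \int[mu]_s (g (a, a * s)%R * (a * \1_pos a)%:E)).
  rewrite [LHS]integral_mkcond; apply: eq_integral => a _; rewrite patchE indicE.
  case: ifPn => apos; last first.
    by rewrite mulr0; apply/esym/integral0_eq => s _; rewrite mule0.
  rewrite mulr1; apply: (@ge0_integral_scale R a (fun b => g (a, b))) => //.
  - by move: apos; rewrite inE/= in_itv/= andbT.
  - by apply: measurable_comp_pair.
have mh : measurable_fun setT (fun z : R * R =>
    g (z.1, z.1 * z.2)%R * (z.1 * \1_pos z.1)%:E).
  apply: emeasurable_funM.
    by apply: measurable_comp_pair => //; exact: measurable_funM.
  apply/measurable_EFinP/measurable_funM; first exact: measurable_fst.
  by apply: measurableT_comp; [exact: measurable_indic|exact: measurable_fst].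
have h0 (z : R * R) : 0 <= g (z.1, z.1 * z.2)%R * (z.1 * \1_pos z.1)%:E.
  rewrite indicE; case: (boolP (z.1 \in pos)) => [|_]; last by rewrite mulr0 mule0.
  rewrite inE/pos/= in_itv/= andbT => /ltW z0.
  by rewrite mulr1 mule_ge0// lee_fin.
rewrite (@fubini_tonelli _ _ _ _ _ mu mu _ mh h0)/=.
rewrite (ge0_integral_atan (measurable_polK mg g0) (fun q => polK_ge0 q g0)).
apply: eq_integral => s _.
have s1 : (0 < 1 + s ^+ 2)%R by rewrite ltr_wpDr// sqr_ge0.
have s2 : (0 < Num.sqrt (1 + s ^+ 2))%R by rewrite sqrtr_gt0.
have cs : (0 < cos (atan s))%R by rewrite cos_atan invr_gt0.
(* This is a = r cos q at q = atan s: a da = cos^2 q r dr, and cos^2 q is the density 1 / (1 + s^2)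
   of the substitution by [atan]. *)
rewrite (ge0_integral_scale cs)//; first last.
- by move=> r; exact: (h0 (r, s)).
- exact: measurable_fun_pair1 mh.
rewrite /polK.
transitivity (\int[mu]_(r in pos) ((g (r * cos (atan s), r * sin (atan s))%R * r%:E) * ((1 + s ^+ 2)^-1)%:E)).
  rewrite [RHS]integral_mkcond; apply: eq_integral => r _ /=; rewrite patchE indicE.
  have -> : ((cos (atan s) * r)%R \in pos) = (r \in pos).
    by apply/idP/idP; rewrite !inE/pos/= !in_itv/= !andbT pmulr_rgt0.
  case: ifPn => rpos; last by rewrite mulr0 mule0 mul0e.
  have -> : (sin (atan s) = cos (atan s) * s)%R.
    by rewrite -[X in (_ = _ * X)%R](atanK s) /tan mulrCA divff ?mulr1// gt_eqF.
  rewrite mulr1 -!muleA; congr (g (_, _) * _).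
  - by rewrite mulrC.
  - by rewrite mulrCA mulrA.
  - rewrite -!EFinM; congr EFin.
    by rewrite cos_atan mulrAC -expr2 exprVn sqr_sqrtr ?ltW// mulrC.
rewrite ge0_integralZr//.
- by apply: measurable_funTS; apply: emeasurable_funM; [|exact/measurable_EFinP];
    apply: measurable_comp_pair => //; exact: measurable_funM.
- by move=> r; rewrite /pos/= in_itv/= andbT => /ltW r0; rewrite mule_ge0// lee_fin.
- by rewrite lee_fin invr_ge0 ltW.
Qed.

(** The left half-plane is the image of the right one under y -> - y, which shifts the angle by pi.
    The two angular intervals then meet at pi/2, and the vertical axis is a null set. *)
Lemma ge0_integral_polar (g : R * R -> \bar R) :
  measurable_fun setT g -> (forall y, 0 <= g y) ->
  \int[mu \x mu]_y g y =
  \int[mu]_(q in `](- (pi / 2))%R, (3%:R * pi / 2)%R[) \int[mu]_(r in `]0%R, +oo[)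
    (g (r * cos q, r * sin q)%R * r%:E).
Proof.
move=> mg g0; have mgN : measurable_fun setT (fun y : R * R => g (- y.1, - y.2)%R).
  by apply: measurable_comp_pair => //; exact: measurableT_comp.
rewrite (_ : \int[mu \x mu]_y g y = \int[mu]_a \int[mu]_b g (a, b)); last first.
  exact: (@fubini_tonelli1 _ _ _ _ _ mu mu g mg g0).
rewrite integral_split0//; last 2 first.
- exact: (@measurable_fun_fubini_tonelli_F _ _ _ _ _ mu _ mg g0).
- by move=> a; apply: integral_ge0.
rewrite half_plane// ge0_integral_oppr//; last 2 first.
- exact: (@measurable_fun_fubini_tonelli_F _ _ _ _ _ mu _ mg g0).
- by move=> a; apply: integral_ge0.
(* Reversing b as well makes the reflection a rotation by pi; reversing a alone would reverse the
   orientation of the angle. *)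
have -> : \int[mu]_(a in `]0%R, +oo[) \int[mu]_b g (- a, b)%R =
    \int[mu]_(a in `]0%R, +oo[) \int[mu]_b g (- a, - b)%R.
  apply: eq_integral => a _; apply: (@ge0_integral_opprT (fun b => g (- a, b)%R)) => //.
  by apply: measurable_comp_pair.
rewrite (half_plane mgN)//.
have pi20 : (0 < pi / 2 :> R)%R by rewrite divr_gt0// pi_gt0.
have pi32 : (3%:R * pi / 2 = pi / 2 + pi :> R)%R by field.
pose J := `](pi / 2)%R, (3%:R * pi / 2)%R[%classic : set R.
have -> : \int[mu]_(q in `](- (pi / 2))%R, (pi / 2)%R[)
      polK (fun y : R * R => g (- y.1, - y.2)%R) q = \int[mu]_(q in J) polK g q.
  rewrite [RHS]integral_mkcond (@ge0_integral_shift R pi); last 2 first.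
  - apply/(measurable_restrictT _ _).1; first exact: measurable_itv.
    by apply: measurable_funTS; exact: measurable_polK.
  - by move=> q; rewrite patchE; case: ifP => // _; exact: polK_ge0.
  rewrite [LHS]integral_mkcond; apply: eq_integral => q _; rewrite !patchE.
  have -> : ((q + pi)%R \in J) = (q \in `](- (pi / 2))%R, (pi / 2)%R[%classic).
    apply/idP/idP; rewrite !inE/J/= !in_itv/= pi32 ltrD2r.
    - by move=> /andP[h ->]; rewrite andbT; lra.
    - by move=> /andP[h ->]; rewrite andbT; lra.
  case: ifP => // _; rewrite /polK; apply: eq_integral => r _.
  by rewrite cosDpi sinDpi !mulrN.
rewrite addeC; have -> : `](- (pi / 2))%R, (3%:R * pi / 2)%R[%classic =
    `](- (pi / 2))%R, (pi / 2)%R[ `|` `[(pi / 2)%R, (3%:R * pi / 2)%R[%classic :> set R.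
  by apply: itv_bndbnd_setU; rewrite bnd_simp; lra.
rewrite ge0_integral_setU//=.
- congr (_ + _); rewrite /J integral_itv_obnd_cbnd//.
  by apply: measurable_funTS; exact: measurable_polK.
- by apply: measurable_funTS; exact: measurable_polK.
- by move=> q _; exact: polK_ge0.
- rewrite disj_set2E; apply/eqP; rewrite -subset0 => q []/=; rewrite !in_itv/=.
  by move=> /andP[_ h] /andP[+ _]; rewrite leNgt h.
Qed.

End polar.

(** * Borel sets of the plane and the product sigma-algebra *)

Lemma open_measurable2 (R : realType) (U : set (R * R)) : open U -> measurable U.
Proof.
move=> oU.
pose box (p q e : rat) := ball (ratr p : R) (ratr e) `*` ball (ratr q : R) (ratr e).
pose V p q e := if `[< box p q e `<=` U >] then box p q e else set0.
rewrite (_ : U = \bigcup_p \bigcup_q \bigcup_e V p q e); last first.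
  apply/seteqP; split=> [[x y] Uxy|[x y] [p _ [q _ [e _]]]]; last first.
    by rewrite /V; case: asboolP => // sub /sub.
  have [/= e e0 eU] : exists2 e : R, 0 < e & ball (x, y) e `<=` U.
    by have /nbhs_ballP[/= e ? ?] := oU _ Uxy; exists e.
  (* Below e / 2, a box of radius d whose centre is d-close to (x, y) stays inside the ball of
     radius e. *)
  have [d] : exists d : rat, ratr d \in `]0, e / 2[%R.
    by apply: rat_in_itvoo; rewrite divr_gt0.
  rewrite in_itv/= => /andP[d0 de].
  have near_rat (z : R) : exists p : rat, ball (ratr p : R) (ratr d) z.
    have [p] : exists p : rat, ratr p \in `]z - ratr d, z + ratr d[%R.
      by apply: rat_in_itvoo; lra.
    rewrite in_itv/= => /andP[h1 h2]; exists p; rewrite /ball/= ltr_norml; lra.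
  have [[p px] [q qy]] := (near_rat x, near_rat y).
  exists p => //; exists q => //; exists d => //; rewrite /V ifT//.
  apply/asboolP => -[u v] [/= pu qv]; apply: eU; split => /=.
    by apply: (@le_ball _ _ _ (ratr d + ratr d)); [lra|apply: ball_triangle pu; exact: ball_sym].
  by apply: (@le_ball _ _ _ (ratr d + ratr d)); [lra|apply: ball_triangle qv; exact: ball_sym].
do 3 (apply: bigcupT_measurable_rat => ?).
rewrite /V; case: ifP => // _; apply: measurableX; exact: measurable_ball.
Qed.

Lemma continuous_measurable_fun2 (R : realType) (f : R * R -> R) :
  continuous f -> measurable_fun setT f.
Proof.
move=> /continuousP cf.
apply: (measurability _ (RGenOpens.measurableE R)) => _ [_ [a [b ->]] <-].
by rewrite setTI; apply: open_measurable2; apply: cf; exact: interval_open.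
Qed.

Local Open Scope complex_scope.

(** * Complex differentiability *)

Section cabs.
Variable R : realType.
Implicit Types (x y z : R[i]) (a b : R).

Lemma cabsE z : cabs z = ComplexField.Normc.normc z.
Proof. by case: z. Qed.

Lemma cabs_ge0 z : 0 <= cabs z. Proof. exact: sqrtr_ge0. Qed.

Lemma cabs0 : cabs (0 : R[i]) = 0.
Proof. by rewrite cabsE ComplexField.Normc.normc0. Qed.

Lemma cabs1 : cabs (1 : R[i]) = 1.
Proof. by rewrite cabsE ComplexField.Normc.normc1. Qed.

Lemma cabsM x y : cabs (x * y) = cabs x * cabs y.
Proof. by rewrite !cabsE ComplexField.Normc.normcM. Qed.

Lemma cabsV x : cabs x^-1 = (cabs x)^-1.
Proof. by rewrite !cabsE ComplexField.Normc.normcV. Qed.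

Lemma cabsN x : cabs (- x) = cabs x.
Proof. by rewrite !cabsE (normcN (x : Rcomplex R)). Qed.

Lemma cabsX x n : cabs (x ^+ n) = cabs x ^+ n.
Proof. by elim: n => [|n IH]; rewrite ?expr0 ?cabs1// !exprS cabsM IH. Qed.

Lemma cabsD x y : cabs (x + y) <= cabs x + cabs y.
Proof. by rewrite !cabsE le_normcD. Qed.

Lemma cabsB x y : cabs (x - y) <= cabs x + cabs y.
Proof. by rewrite -(cabsN y) cabsD. Qed.

Lemma cabs_eq0 z : (cabs z == 0) = (z == 0).
Proof.
apply/eqP/eqP => [|->]; last exact: cabs0.
by rewrite cabsE; exact: ComplexField.Normc.eq0_normc.
Qed.

Lemma cabs_gt0 z : (0 < cabs z) = (z != 0).
Proof. by rewrite lt_neqAle cabs_ge0 andbT eq_sym cabs_eq0. Qed.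

Lemma cabs_real a : cabs a%:C = `|a|.
Proof. by rewrite /cabs/= expr0n/= addr0 sqrtr_sqr. Qed.

Lemma cabs_i : cabs ('i%R : R[i]) = 1.
Proof. by rewrite -complexiE /cabs/= expr0n expr1n add0r sqrtr1. Qed.

Lemma sqr_cabs z : cabs z ^+ 2 = complex.Re z ^+ 2 + complex.Im z ^+ 2.
Proof. by rewrite sqr_sqrtr// addr_ge0// sqr_ge0. Qed.

Lemma norm_Re_le_cabs z : `|complex.Re z| <= cabs z.
Proof. by rewrite -sqrtr_sqr ler_wsqrtr// lerDl sqr_ge0. Qed.

Lemma norm_Im_le_cabs z : `|complex.Im z| <= cabs z.
Proof. by rewrite -sqrtr_sqr ler_wsqrtr// lerDr sqr_ge0. Qed.

Lemma cabs_le_ReIm z : cabs z <= `|complex.Re z| + `|complex.Im z|.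
Proof.
rewrite -(@ler_pXn2r _ 2) ?nnegrE ?cabs_ge0 ?addr_ge0//.
rewrite sqr_cabs sqrrD !real_normK ?num_real//.
by rewrite -addrA lerD2l lerDr mulrn_wge0// mulr_ge0.
Qed.

Lemma ReM x y : complex.Re (x * y) =
  complex.Re x * complex.Re y - complex.Im x * complex.Im y.
Proof. by case: x y => [? ?] [? ?]. Qed.

Lemma ImM x y : complex.Im (x * y) =
  complex.Re x * complex.Im y + complex.Im x * complex.Re y.
Proof. by case: x y => [? ?] [? ?]. Qed.

Lemma ReD x y : complex.Re (x + y) = complex.Re x + complex.Re y.
Proof. by case: x y => [? ?] [? ?]. Qed.

Lemma ImD x y : complex.Im (x + y) = complex.Im x + complex.Im y.
Proof. by case: x y => [? ?] [? ?]. Qed.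

Lemma ReN x : complex.Re (- x) = - complex.Re x.
Proof. by case: x. Qed.

Lemma ImN x : complex.Im (- x) = - complex.Im x.
Proof. by case: x. Qed.

Lemma complex_ext x y :
  complex.Re x = complex.Re y -> complex.Im x = complex.Im y -> x = y.
Proof. by case: x y => [? ?] [? ?] /= -> ->. Qed.

Lemma cexpD x y : cexp (x + y) = cexp x * cexp y.
Proof.
apply: complex_ext; rewrite ?ReM ?ImM /cexp/= ReD ImD expRD ?cosD ?sinD; ring.
Qed.

Lemma cexp0 : cexp (0 : R[i]) = 1.
Proof. by rewrite /cexp/= expR0 cos0 sin0 !mul1r. Qed.

Lemma cexp_real a : cexp a%:C = (expR a)%:C.
Proof. by rewrite /cexp/= cos0 sin0 mulr1 mulr0. Qed.

Lemma cabs_cexp z : cabs (cexp z) = expR (complex.Re z).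
Proof.
rewrite /cabs/= !exprMn -mulrDr cos2Dsin2 mulr1 sqrtr_sqr ger0_norm//.
Qed.

End cabs.

Section real_bounds.
Variable R : realType.
Implicit Types x y : R.

Lemma norm_expR_sub1 x : `|expR x - 1| <= `|x| * expR `|x|.
Proof.
have h1 := expR_ge1Dx x; have h2 := expR_ge1Dx (- x).
have e0 := expR_gt0 x.
have h3 : expR x - 1 <= x * expR x.
  have : (1 - x) * expR x <= 1.
    rewrite -[leRHS](expRxMexpNx_1 x) mulrC ler_pM2l//.
  lra.
have [x0|x0] := leP 0 x.
  by rewrite (ger0_norm x0) ger0_norm//; lra.
rewrite (ltr0_norm x0) ler0_norm; last by rewrite subr_le0 -expR0 ler_expR ltW.
have : 1 <= expR (- x) by rewrite -expR0 ler_expR; lra.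
nra.
Qed.

Lemma norm_expR_sub1D x : `|expR x - 1 - x| <= x ^+ 2 * expR `|x|.
Proof.
have h1 := expR_ge1Dx x; have h2 := expR_ge1Dx (- x).
have e0 := expR_gt0 x.
have h3 : expR x - 1 <= x * expR x.
  have : (1 - x) * expR x <= 1.
    rewrite -[leRHS](expRxMexpNx_1 x) mulrC ler_pM2l//.
  lra.
rewrite ger0_norm; last lra.
apply: (@le_trans _ _ (x * (expR x - 1))); first lra.
apply: (le_trans (ler_norm _)); rewrite normrM.
rewrite -[x ^+ 2]real_normK ?num_real// expr2 -mulrA ler_wpM2l//.
exact: norm_expR_sub1.
Qed.

(** The mean value theorem between 0 and x. Each use raises the order of vanishing by one: from the
    bound on [sin] to that on cos x - 1, and from there to sin x - x. *)
Lemma norm_lipschitz (f df : R -> R) (K x : R) :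
  (forall y, is_derive y (1 : R) f (df y)) ->
  (forall y, `|y| <= `|x| -> `|df y| <= K) -> `|f x - f 0| <= K * `|x|.
Proof.
move=> fd dfK.
have cf : continuous f.
  by move=> y; apply/differentiable_continuous/derivable1_diffP.
have [x0|x0|->] := ltgtP x 0.
- have [c] := MVT x0 (fun y _ => fd y) (continuous_subspaceT cf).
  rewrite in_itv/= => /andP[xc c0] e.
  rewrite distrC e sub0r normrM normrN ler_wpM2r// dfK//.
  rewrite !ler0_norm; lra.
- have [c] := MVT x0 (fun y _ => fd y) (continuous_subspaceT cf).
  rewrite in_itv/= => /andP[xc c0] e.
  rewrite e subr0 normrM ler_wpM2r// dfK//.
  rewrite !ger0_norm; lra.
- by rewrite subrr normr0 mulr0.
Qed.

Lemma norm_sin_le x : `|sin x| <= `|x|.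
Proof.
have := @norm_lipschitz sin cos 1 x; rewrite sin0 subr0 mul1r; apply.
by move=> y _; exact: cos_max.
Qed.

Lemma norm_cos_sub1 x : `|cos x - 1| <= x ^+ 2.
Proof.
rewrite -cos0 -[x ^+ 2]real_normK ?num_real// expr2.
apply: (@norm_lipschitz cos (fun y => - sin y)) => y yx.
by rewrite normrN (le_trans (norm_sin_le y)).
Qed.

Lemma norm_sin_subx x : `|sin x - x| <= `|x| ^+ 3.
Proof.
have := @norm_lipschitz (fun y => sin y - y) (fun y => cos y - 1) (`|x| ^+ 2) x.
rewrite sin0 !subr0 => /(_ _ _)/le_trans; apply => //.
- move=> y yx; apply: (le_trans (norm_cos_sub1 y)).
  by rewrite -[y ^+ 2]real_normK ?num_real// lerXn2r// nnegrE.
- by rewrite -exprSr.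
Qed.

End real_bounds.

Section ccont.
Context {R : realType}.

(* R[i] carries no topology in the library. *)
Definition ccont_at {T : topologicalType} (f : T -> R[i]) (x : T) :=
  complex.Re (f y) @[y --> x] --> complex.Re (f x) /\
  complex.Im (f y) @[y --> x] --> complex.Im (f x).

Definition ccont {T : topologicalType} (f : T -> R[i]) := forall x, ccont_at f x.

Section closure.
Context {T : topologicalType}.
Implicit Types (f g : T -> R[i]) (x : T).

Lemma ccont_at_ext f g x : f =1 g -> ccont_at f x -> ccont_at g x.
Proof. by move=> /funext ->. Qed.

Lemma ccont_at_cst (c : R[i]) x : ccont_at (fun=> c) x.
Proof. by split; exact: cvg_cst. Qed.

Lemma ccont_atD f g x : ccont_at f x -> ccont_at g x ->
  ccont_at (fun y => f y + g y) x.
Proof.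
move=> [f1 f2] [g1 g2]; split.
- by rewrite ReD; under eq_fun do rewrite ReD; exact: cvgD.
- by rewrite ImD; under eq_fun do rewrite ImD; exact: cvgD.
Qed.

Lemma ccont_atN f x : ccont_at f x -> ccont_at (fun y => - f y) x.
Proof.
move=> [f1 f2]; split.
- by rewrite ReN; under eq_fun do rewrite ReN; exact: cvgN.
- by rewrite ImN; under eq_fun do rewrite ImN; exact: cvgN.
Qed.

Lemma ccont_atM f g x : ccont_at f x -> ccont_at g x ->
  ccont_at (fun y => f y * g y) x.
Proof.
move=> [f1 f2] [g1 g2]; split.
- by rewrite ReM; under eq_fun do rewrite ReM; apply: cvgB; exact: cvgM.
- by rewrite ImM; under eq_fun do rewrite ImM; apply: cvgD; exact: cvgM.
Qed.

Lemma ccont_at_real (f : T -> R) x : {for x, continuous f} ->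
  ccont_at (fun y => (f y)%:C) x.
Proof. by move=> cf; split => //=; exact: cvg_cst. Qed.

Lemma ccont_atP f x : ccont_at f x <->
  forall e, 0 < e -> \forall y \near x, cabs (f y - f x) < e.
Proof.
split=> [[f1 f2] e e0|h].
- have e20 : 0 < e / 2 by rewrite divr_gt0.
  move/cvgrPdist_lt : f1 => /(_ _ e20) f1; move/cvgrPdist_lt : f2 => /(_ _ e20) f2.
  near=> y; apply: (le_lt_trans (cabs_le_ReIm _)).
  rewrite ReD ImD ReN ImN (splitr e) distrC [X in _ + X]distrC.
  by apply: ltrD; near: y.
- split; apply/cvgrPdist_lt => e e0; near=> y; rewrite distrC.
  + rewrite -ReN -ReD; apply: (le_lt_trans (norm_Re_le_cabs _)).
    by near: y; exact: h.
  + rewrite -ImN -ImD; apply: (le_lt_trans (norm_Im_le_cabs _)).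
    by near: y; exact: h.
Unshelve. all: by end_near. Qed.

Lemma ccont_at_cexp f x : ccont_at f x -> ccont_at (fun y => cexp (f y)) x.
Proof.
move=> [f1 f2]; split; rewrite /cexp/=; apply: cvgM.
- by apply: (cvg_comp _ _ f1); exact: continuous_expR.
- by apply: (cvg_comp _ _ f2); exact: continuous_cos.
- by apply: (cvg_comp _ _ f1); exact: continuous_expR.
- by apply: (cvg_comp _ _ f2); exact: continuous_sin.
Qed.

End closure.

Definition complex_of_pair (p : R * R) : R[i] := p.1 +i* p.2.

Definition pair_of_complex (z : R[i]) : R * R := (complex.Re z, complex.Im z).

Lemma pair_of_complexK : cancel pair_of_complex complex_of_pair. Proof. by case. Qed.

Lemma ccont_complex_of_pair : ccont complex_of_pair.
Proof. by move=> p; split; [exact: cvg_fst|exact: cvg_snd]. Qed.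

Lemma ccont_at_pair_of_complex {T : topologicalType} (f : T -> R[i]) x :
  ccont_at f x -> {for x, continuous (pair_of_complex \o f)}.
Proof. by move=> [f1 f2]; exact: (cvg_pair f1 f2). Qed.

Lemma ccont_at_comp_pair {T : topologicalType} (g : R * R -> R[i]) (f : T -> R * R) x :
  {for x, continuous f} -> ccont_at g (f x) -> ccont_at (g \o f) x.
Proof. by move=> cf [g1 g2]; split; [exact: (cvg_comp _ _ cf g1)|exact: (cvg_comp _ _ cf g2)]. Qed.

(* Carathéodory's form of complex differentiability: the difference quotient
   extends continuously to the increment 0. *)
Definition cdiff (f : R[i] -> R[i]) (z : R[i]) :=
  exists2 q : R * R -> R[i],
    forall p, f (z + complex_of_pair p) = f z + q p * complex_of_pair p & ccont_at q (0, 0).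

Implicit Types f g : R[i] -> R[i].

Lemma complex_of_pair0 : complex_of_pair (0, 0) = 0. Proof. by []. Qed.

Lemma cdiff_ext f g z : f =1 g -> cdiff f z -> cdiff g z.
Proof. by move=> /funext ->. Qed.

Lemma cdiff_cst (c : R[i]) z : cdiff (fun=> c) z.
Proof.
by exists (fun=> 0) => [p|]; [rewrite mul0r addr0|exact: ccont_at_cst].
Qed.

Lemma cdiff_id z : cdiff id z.
Proof. by exists (fun=> 1) => [p|]; [rewrite mul1r|exact: ccont_at_cst]. Qed.

Lemma cdiffD f g z : cdiff f z -> cdiff g z -> cdiff (fun x => f x + g x) z.
Proof.
move=> [q fq cq] [r gr cr]; exists (fun p => q p + r p); last exact: ccont_atD.
by move=> p; rewrite fq gr; ring.
Qed.

Lemma cdiffM f g z : cdiff f z -> cdiff g z -> cdiff (fun x => f x * g x) z.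
Proof.
move=> [q fq cq] [r gr cr].
exists (fun p => q p * g z + f z * r p + q p * r p * complex_of_pair p).
  by move=> p; rewrite fq gr; ring.
apply: ccont_atD; last by apply: ccont_atM; [exact: ccont_atM|exact: ccont_complex_of_pair].
by apply: ccont_atD; apply: ccont_atM => //; exact: ccont_at_cst.
Qed.

Lemma cdiffZ (c : R[i]) f z : cdiff f z -> cdiff (fun x => c * f x) z.
Proof. by move=> cf; apply: cdiffM => //; exact: cdiff_cst. Qed.

Lemma cdiffX f n z : cdiff f z -> cdiff (fun x => f x ^+ n) z.
Proof.
move=> cf; elim: n => [|n IH].
  by apply: (@cdiff_ext (fun=> 1)) => [x|]; [rewrite expr0|exact: cdiff_cst].
by apply: (@cdiff_ext (fun x => f x * f x ^+ n)) => [x|]; [rewrite exprS|exact: cdiffM].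
Qed.

Lemma cdiff_comp f g z : cdiff g z -> cdiff f (g z) -> cdiff (f \o g) z.
Proof.
move=> [r gr cr] [q fq cq].
exists (fun p => q (pair_of_complex (r p * complex_of_pair p)) * r p).
  by move=> p /=; rewrite gr -{1}(pair_of_complexK (r p * complex_of_pair p)) fq pair_of_complexK mulrA.
apply: ccont_atM => //; apply: ccont_at_comp_pair.
  by apply: ccont_at_pair_of_complex; apply: ccont_atM => //; exact: ccont_complex_of_pair.
by rewrite /= complex_of_pair0 mulr0.
Qed.

Lemma near0_cabs (P : R * R -> Prop) d : 0 < d ->
  (forall p, cabs (complex_of_pair p) < d -> P p) -> \forall p \near (0 : R, 0 : R), P p.
Proof.
move=> d0 dP; have /ccont_atP/(_ _ d0) := ccont_complex_of_pair (0, 0).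
by apply: filterS => p; rewrite complex_of_pair0 subr0 => /dP.
Qed.

Lemma cdiff_lim f z a :
  (forall e, 0 < e -> exists2 d, 0 < d & forall h, cabs h < d ->
     cabs (f (z + h) - f z - a * h) <= e * cabs h) -> cdiff f z.
Proof.
move=> fa; exists (fun p => if complex_of_pair p == 0 then a else (f (z + complex_of_pair p) - f z) / complex_of_pair p).
  move=> p; case: ifPn => [/eqP ->|p0]; first by rewrite mulr0 !addr0.
  by rewrite divfK// [RHS]addrC subrK.
apply/ccont_atP => e e0; have e20 : 0 < e / 2 by rewrite divr_gt0.
have [d d0 dP] := fa _ e20; apply: (near0_cabs d0) => p /dP h.
rewrite complex_of_pair0 eqxx; case: ifPn => [_|p0]; first by rewrite subrr cabs0.
have cp : 0 < cabs (complex_of_pair p) by rewrite cabs_gt0.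
rewrite -(ltr_pM2r cp) -cabsM mulrBl divfK//.
by apply: (le_lt_trans h); rewrite ltr_pM2r// ltr_pdivrMr// ltr_pMr// ltr1n.
Qed.

(** The form in which the exponential and [Lambda] are differentiated: both come with a second-order
    remainder estimate. *)
Lemma cdiff_quadratic f z a K : (forall h, cabs h <= 1 ->
  cabs (f (z + h) - f z - a * h) <= K * cabs h ^+ 2) -> cdiff f z.
Proof.
move=> fK; apply: (@cdiff_lim _ _ a) => e e0.
have K0 : 0 < `|K| + 1 by rewrite ltr_wpDl.
exists (Num.min 1 (e / (`|K| + 1))); first by rewrite lt_min ltr01 divr_gt0.
move=> h; rewrite lt_min => /andP[/ltW h1 he].
apply: (le_trans (fK _ h1)); rewrite expr2 mulrA ler_wpM2r ?cabs_ge0//.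
move: he; rewrite ltr_pdivlMr// => he.
have := ler_norm K; have := cabs_ge0 h; nra.
Qed.

(** With h = x + iy, the 4 counts the pieces e^x - 1 - x, e^x (cos y - 1), (e^x - 1) sin y and sin y
    - y, each of modulus at most |h|^2 e^{|h|}. *)
Lemma cexp_sub1_bound (h : R[i]) :
  cabs (cexp h - 1 - h) <= 4 * cabs h ^+ 2 * expR (cabs h).
Proof.
apply: (le_trans (cabs_le_ReIm _)).
rewrite !ReD !ImD !ReN !ImN /=.
set x := complex.Re h; set y := complex.Im h.
have xh : `|x| <= cabs h by exact: norm_Re_le_cabs.
have yh : `|y| <= cabs h by exact: norm_Im_le_cabs.
have e0 : 0 < expR x by exact: expR_gt0.
have ex : expR x <= expR (cabs h).
  by rewrite ler_expR (le_trans (ler_norm _)).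
have ex' : expR `|x| <= expR (cabs h) by rewrite ler_expR.
have c0 := cabs_ge0 h.
have x2 : x ^+ 2 <= cabs h ^+ 2.
  by rewrite -[x ^+ 2]real_normK ?num_real// lerXn2r// nnegrE.
have y2 : y ^+ 2 <= cabs h ^+ 2.
  by rewrite -[y ^+ 2]real_normK ?num_real// lerXn2r// nnegrE.
have h1 : `|expR x - 1 - x| <= cabs h ^+ 2 * expR (cabs h).
  apply: (le_trans (norm_expR_sub1D x)); apply: ler_pM => //.
  exact: sqr_ge0.
have h2 : `|expR x * (cos y - 1)| <= cabs h ^+ 2 * expR (cabs h).
  rewrite normrM (ger0_norm (ltW e0)) mulrC; apply: ler_pM => //.
  exact: le_trans (norm_cos_sub1 y) y2.
have h3 : `|(expR x - 1) * sin y| <= cabs h ^+ 2 * expR (cabs h).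
  rewrite normrM; apply: (@le_trans _ _ ((`|x| * expR `|x|) * `|y|)).
    by apply: ler_pM => //; [exact: norm_expR_sub1|exact: norm_sin_le].
  rewrite mulrAC expr2; apply: ler_pM => //.
  exact: ler_pM.
have h4 : `|sin y - y| <= cabs h ^+ 2 * expR (cabs h).
  have sy1 : `|sin y - y| <= `|y| ^+ 3 := norm_sin_subx y.
  apply: (le_trans sy1); rewrite exprSr; apply: ler_pM => //.
  - by rewrite lerXn2r// nnegrE.
  - by apply: (le_trans yh); have := expR_ge1Dx (cabs h); lra.
have -> : expR x * cos y - 1 - x = (expR x - 1 - x) + expR x * (cos y - 1) by ring.
have -> : expR x * sin y - 0 - y = (expR x - 1) * sin y + (sin y - y) by ring.
have := ler_normD (expR x - 1 - x) (expR x * (cos y - 1)).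
have := ler_normD ((expR x - 1) * sin y) (sin y - y).
lra.
Qed.

Lemma cdiff_cexp z : cdiff (@cexp R) z.
Proof.
apply: (@cdiff_quadratic _ _ (cexp z) (cabs (cexp z) * (4 * expR 1))) => h h1.
have -> : cexp (z + h) - cexp z - cexp z * h = cexp z * (cexp h - 1 - h).
  by rewrite cexpD; ring.
rewrite cabsM -mulrA ler_wpM2l ?cabs_ge0//.
apply: (le_trans (cexp_sub1_bound h)); rewrite mulrAC ler_wpM2r ?exprn_ge0 ?cabs_ge0//.
by rewrite ler_wpM2l// ler_expR.
Qed.

Lemma cdiffP f z : cdiff f z -> exists a, forall e, 0 < e ->
  exists2 d, 0 < d & forall h, cabs h < d ->
     cabs (f (z + h) - f z - a * h) <= e * cabs h.
Proof.
move=> [q fq /ccont_atP cq]; exists (q (0, 0)) => e /cq/nbhs_ballP[d /= d0 dq].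
exists d => // h hd.
have -> : f (z + h) - f z - q (0, 0) * h = (q (pair_of_complex h) - q (0, 0)) * h.
  by rewrite -{1}(pair_of_complexK h) fq pair_of_complexK; ring.
rewrite cabsM ler_wpM2r ?cabs_ge0// ltW//; apply: dq; split; rewrite /ball/= sub0r normrN.
- exact: le_lt_trans (norm_Re_le_cabs _) hd.
- exact: le_lt_trans (norm_Im_le_cabs _) hd.
Qed.

Lemma cdiff_ccont {T : topologicalType} f (g : T -> R[i]) x :
  cdiff f (g x) -> ccont_at g x -> ccont_at (f \o g) x.
Proof.
move=> [q fq cq] cg.
apply: (@ccont_at_ext _ ((fun p => f (g x) + q p * complex_of_pair p) \o (fun y => pair_of_complex (g y - g x)))).
  by move=> y /=; rewrite -fq pair_of_complexK addrC subrK.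
apply: ccont_at_comp_pair.
  apply: (@ccont_at_pair_of_complex _ (fun y => g y - g x)); apply: ccont_atD => //.
  exact: ccont_at_cst.
rewrite subrr; apply: ccont_atD; first exact: ccont_at_cst.
by apply: ccont_atM => //; exact: ccont_complex_of_pair.
Qed.

End ccont.

(** * Complex integrals and Goursat's theorem *)

Section cintegral_theory.
Context d (T : measurableType d) (R : realType).
Variables (mu : {measure set T -> \bar R}) (D : set T).
Hypothesis mD : measurable D.
Implicit Types f g : T -> R[i].

Lemma eq_cintegral f g : {in D, f =1 g} -> cintegral mu D f = cintegral mu D g.
Proof.
by move=> fg; congr (_ +i* _); apply: eq_Rintegral => x xD; rewrite fg.
Qed.

Lemma eq_cintegrable f g : {in D, f =1 g} ->
  cintegrable mu D f -> cintegrable mu D g.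
Proof.
by move=> fg [f1 f2]; split; [move: f1|move: f2]; apply: eq_integrable => // x xD;
  rewrite /= fg.
Qed.

Lemma cintegrableD f g : cintegrable mu D f -> cintegrable mu D g ->
  cintegrable mu D (fun x => f x + g x).
Proof.
move=> [f1 f2] [g1 g2]; split.
- by apply: eq_integrable (integrableD mD f1 g1) => // x _; rewrite /= ReD.
- by apply: eq_integrable (integrableD mD f2 g2) => // x _; rewrite /= ImD.
Qed.

Lemma cintegralD f g : cintegrable mu D f -> cintegrable mu D g ->
  cintegral mu D (fun x => f x + g x) = cintegral mu D f + cintegral mu D g.
Proof.
move=> [f1 f2] [g1 g2]; apply: complex_ext; rewrite ?ReD ?ImD/= -RintegralD//.
- by apply: eq_Rintegral => x _; rewrite ReD.
- by apply: eq_Rintegral => x _; rewrite ImD.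
Qed.

Lemma cintegrableZ (c : R[i]) f : cintegrable mu D f ->
  cintegrable mu D (fun x => c * f x).
Proof.
move=> [f1 f2]; split.
- have := integrableB mD (integrableZl mD (complex.Re c) f1) (integrableZl mD (complex.Im c) f2).
  by apply: eq_integrable => // x _; rewrite /= ReM.
- have := integrableD mD (integrableZl mD (complex.Re c) f2) (integrableZl mD (complex.Im c) f1).
  by apply: eq_integrable => // x _; rewrite /= ImM.
Qed.

Lemma cintegralZ (c : R[i]) f : cintegrable mu D f ->
  cintegral mu D (fun x => c * f x) = c * cintegral mu D f.
Proof.
move=> [f1 f2].
have [r1 r2] : mu.-integrable D (EFin \o (fun x => complex.Re c * complex.Re (f x))) /\
    mu.-integrable D (EFin \o (fun x => complex.Im c * complex.Re (f x))).
  by split; apply: eq_integrable (integrableZl mD _ f1).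
have [i1 i2] : mu.-integrable D (EFin \o (fun x => complex.Re c * complex.Im (f x))) /\
    mu.-integrable D (EFin \o (fun x => complex.Im c * complex.Im (f x))).
  by split; apply: eq_integrable (integrableZl mD _ f2).
apply: complex_ext; rewrite ?ReM ?ImM/=.
- rewrite -!RintegralZl// -RintegralB//.
  by apply: eq_Rintegral => x _; rewrite ReM.
- rewrite -!RintegralZl// -RintegralD//.
  by apply: eq_Rintegral => x _; rewrite ImM.
Qed.

Lemma cintegrableB f g : cintegrable mu D f -> cintegrable mu D g ->
  cintegrable mu D (fun x => f x - g x).
Proof.
move=> fi gi; apply: (@eq_cintegrable (fun x => f x + -1 * g x)).
  by move=> x _; rewrite mulN1r.
by apply: cintegrableD => //; exact: cintegrableZ.
Qed.

Lemma cintegralB f g : cintegrable mu D f -> cintegrable mu D g ->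
  cintegral mu D (fun x => f x - g x) = cintegral mu D f - cintegral mu D g.
Proof.
move=> fi gi; rewrite (@eq_cintegral _ (fun x => f x + -1 * g x)); last first.
  by move=> x _; rewrite mulN1r.
rewrite cintegralD//; last exact: cintegrableZ.
by rewrite cintegralZ// mulN1r.
Qed.

Lemma cintegrable_le f (g : T -> R) :
  measurable_fun D (fun x => complex.Re (f x)) ->
  measurable_fun D (fun x => complex.Im (f x)) ->
  mu.-integrable D (EFin \o g) -> (forall x, D x -> cabs (f x) <= g x) ->
  cintegrable mu D f.
Proof.
move=> m1 m2 gi fg; split; apply: (le_integrable mD _ _ gi).
- exact/measurable_EFinP.
- move=> x Dx /=; rewrite lee_fin (le_trans (norm_Re_le_cabs _))//.
  by rewrite (le_trans (fg _ Dx))// ler_norm.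
- exact/measurable_EFinP.
- move=> x Dx /=; rewrite lee_fin (le_trans (norm_Im_le_cabs _))//.
  by rewrite (le_trans (fg _ Dx))// ler_norm.
Qed.

(** The factor 2 is the price of estimating real and imaginary part separately; every use tolerates
    a constant. *)
Lemma cabs_cintegral_le f (g : T -> R) : cintegrable mu D f ->
  mu.-integrable D (EFin \o g) -> (forall x, D x -> cabs (f x) <= g x) ->
  cabs (cintegral mu D f) <= 2 * \int[mu]_(x in D) g x.
Proof.
move=> [f1 f2] gi fg; apply: (le_trans (cabs_le_ReIm _)) => /=.
rewrite mulr_natl mulr2n lerD//.
- apply: (le_trans (le_normr_Rintegral mD f1)); apply: le_Rintegral => //.
  + exact: (integrable_abse f1).
  + by move=> x Dx; rewrite (le_trans (norm_Re_le_cabs _))// fg.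
- apply: (le_trans (le_normr_Rintegral mD f2)); apply: le_Rintegral => //.
  + exact: (integrable_abse f2).
  + by move=> x Dx; rewrite (le_trans (norm_Im_le_cabs _))// fg.
Qed.

End cintegral_theory.

Section segments.
Context {R : realType}.
Notation mu := (@lebesgue_measure R).
Implicit Types (f g : R -> R[i]) (a b c : R).

Definition seg_int f a b := cintegral mu `[a, b] f.

Lemma ccont_cintegrable f a b : ccont f -> cintegrable mu `[a, b] f.
Proof.
move=> cf; split; apply: continuous_compact_integrable; try exact: segment_compact;
  by apply: continuous_subspaceT => x; have [] := cf x.
Qed.

Lemma seg_intB f g a b : ccont f -> ccont g ->
  seg_int (fun x => f x - g x) a b = seg_int f a b - seg_int g a b.
Proof. by move=> cf cg; apply: cintegralB => //; exact: ccont_cintegrable. Qed.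

Lemma seg_int_cat f a b c : ccont f -> a <= c -> c <= b ->
  seg_int f a b = seg_int f a c + seg_int f c b.
Proof.
move=> cf ac cb.
have cat (h : R -> R) : mu.-integrable `[a, b] (EFin \o h) ->
    \int[mu]_(x in `[a, b]) h x =
    \int[mu]_(x in `[a, c]) h x + \int[mu]_(x in `[c, b]) h x.
  move=> hi; apply/eqP; rewrite addrC -subr_eq; apply/eqP.
  rewrite (@Rintegral_itvB _ _ (BLeft a) (BRight b) c) ?bnd_simp//.
  rewrite Rintegral_itv_obnd_cbnd//.
  apply: integrableS hi => //; apply: subset_itv; by rewrite bnd_simp.
by have [f1 f2] := ccont_cintegrable a b cf; apply: complex_ext;
  rewrite ?ReD ?ImD /=; exact: cat.
Qed.

Lemma fine_lebesgue_itv a b : a <= b -> fine (mu `[a, b]) = b - a.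
Proof.
move=> ab; rewrite lebesgue_measure_itv/= lte_fin; case: ltgtP ab => //= -> _.
by rewrite subrr.
Qed.

Lemma seg_int_cst (k : R[i]) a b : a <= b -> seg_int (fun=> k) a b = k * (b - a)%:C.
Proof.
move=> /fine_lebesgue_itv e.
by apply: complex_ext; rewrite ?ReM ?ImM/= Rintegral_cst// e; ring.
Qed.

Lemma cabs_seg_int_sub f (k : R[i]) (K a b : R) : ccont f -> a <= b ->
  (forall x, a <= x <= b -> cabs (f x - k) <= K) ->
  cabs (seg_int f a b - k * (b - a)%:C) <= 2 * (K * (b - a)).
Proof.
move=> cf ab fK; rewrite -(seg_int_cst k ab) -seg_intB//; last first.
  by move=> x; exact: ccont_at_cst.
have -> : K * (b - a) = \int[mu]_(x in `[a, b]) K.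
  by rewrite Rintegral_cst// fine_lebesgue_itv.
apply: cabs_cintegral_le => //.
- apply: ccont_cintegrable => x; apply: ccont_atD => //.
  by apply: ccont_atN; exact: ccont_at_cst.
- apply: continuous_compact_integrable; first exact: segment_compact.
  by apply: continuous_subspaceT => x; exact: cvg_cst.
Qed.

End segments.

Section goursat.
Context {R : realType}.
Implicit Types (a b c d x y : R).
Variable g : R[i] -> R[i].
Hypothesis gd : forall z, cdiff g z.


Lemma ccont_hline b : ccont (fun a => g (a +i* b)).
Proof.
move=> x; apply: (@cdiff_ccont _ _ _ (fun a => a +i* b)) => //.
by split; [exact: cvg_id|exact: cvg_cst].
Qed.

Lemma ccont_vline a : ccont (fun b => g (a +i* b)).
Proof.
move=> x; apply: (@cdiff_ccont _ _ _ (fun b => a +i* b)) => //.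
by split; [exact: cvg_cst|exact: cvg_id].
Qed.

(** The counterclockwise integral over the boundary of [a, a'] x [b, b']. Opposite sides share one
    integral, so that an affine g contributes a constant integrand on each pair. *)
Definition rect_int a a' b b' :=
  seg_int (fun x => g (x +i* b) - g (x +i* b')) a a' +
  'i%R * seg_int (fun y => g (a' +i* y) - g (a +i* y)) b b'.

(** The inner sides are run through twice, in opposite directions. *)
Lemma rect_int_split a c a' b d b' : a <= c -> c <= a' -> b <= d -> d <= b' ->
  rect_int a a' b b' = rect_int a c b d + rect_int c a' b d +
                       rect_int a c d b' + rect_int c a' d b'.
Proof.
move=> ac ca bd db; rewrite /rect_int !seg_intB//;
  try exact: ccont_hline; try exact: ccont_vline.
rewrite (seg_int_cat (ccont_hline b) ac ca) (seg_int_cat (ccont_hline b') ac ca).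
rewrite (seg_int_cat (ccont_vline a) bd db) (seg_int_cat (ccont_vline a') bd db).
ring.
Qed.

(** The affine part of g at z integrates to 0, and the rest is at most e D on the boundary, D being
    the half perimeter. Pairing opposite sides and the modulus estimate cost a factor 2 each. *)
Lemma rect_int_near (z k : R[i]) (e r a a' b b' : R) :
  (forall h, cabs h < r -> cabs (g (z + h) - g z - k * h) <= e * cabs h) ->
  0 <= e -> a <= complex.Re z <= a' -> b <= complex.Im z <= b' ->
  (a' - a) + (b' - b) < r ->
  cabs (rect_int a a' b b') <= 4 * e * ((a' - a) + (b' - b)) ^+ 2.
Proof.
move=> gk e0 /andP[az za] /andP[bz zb].
set D := (a' - a) + (b' - b) => Dr.
have gz x y : a <= x <= a' -> b <= y <= b' ->
    cabs (g (x +i* y) - g z - k * (x +i* y - z)) <= e * D.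
  move=> /andP[ax xa] /andP[by_ yb].
  have hD : cabs (x +i* y - z) <= D.
    apply: (le_trans (cabs_le_ReIm _)); rewrite ReD ImD ReN ImN /=.
    by rewrite lerD// ler_norml; lra.
  have := gk (x +i* y - z) (le_lt_trans hD Dr).
  rewrite [z + _]addrC subrK => /le_trans; apply.
  exact: ler_wpM2l.
have aa' : a <= a' by lra.
have bb' : b <= b' by lra.
have hor x : a <= x <= a' ->
    cabs (g (x +i* b) - g (x +i* b') - - (k * 'i%R * (b' - b)%:C)) <= 2 * (e * D).
  move=> xa.
  have -> : g (x +i* b) - g (x +i* b') - - (k * 'i%R * (b' - b)%:C) =
      (g (x +i* b) - g z - k * (x +i* b - z)) - (g (x +i* b') - g z - k * (x +i* b' - z)).
    have -> : x +i* b' = x +i* b + 'i%R * (b' - b)%:C.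
      by rewrite -complexiE; apply: complex_ext; rewrite ?ReD ?ImD ?ReM ?ImM/=; ring.
    ring.
  apply: (le_trans (cabsB _ _)); rewrite mulr_natl mulr2n.
  by apply: lerD; apply: gz => //; rewrite lexx ?bb' ?aa'.
have ver y : b <= y <= b' ->
    cabs (g (a' +i* y) - g (a +i* y) - k * (a' - a)%:C) <= 2 * (e * D).
  move=> yb.
  have -> : g (a' +i* y) - g (a +i* y) - k * (a' - a)%:C =
      (g (a' +i* y) - g z - k * (a' +i* y - z)) - (g (a +i* y) - g z - k * (a +i* y - z)).
    have -> : a' +i* y = a +i* y + (a' - a)%:C.
      by apply: complex_ext; rewrite ?ReD ?ImD/=; ring.
    ring.
  apply: (le_trans (cabsB _ _)); rewrite mulr_natl mulr2n.
  by apply: lerD; apply: gz => //; rewrite lexx ?bb' ?aa'.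
have hc : ccont (fun x => g (x +i* b) - g (x +i* b')).
  move=> x; apply: ccont_atD; first exact: ccont_hline.
  by apply: ccont_atN; exact: ccont_hline.
have vc : ccont (fun y => g (a' +i* y) - g (a +i* y)).
  move=> x; apply: ccont_atD; first exact: ccont_vline.
  by apply: ccont_atN; exact: ccont_vline.
have h1 := cabs_seg_int_sub hc aa' hor.
have h2 := cabs_seg_int_sub vc bb' ver.
rewrite /rect_int.
set I1 := seg_int _ a a' in h1 *; set I2 := seg_int _ b b' in h2 *.
(* The two affine contributions, - i k (b' - b)(a' - a) and i k (a' - a)(b' - b), cancel. *)
have -> : I1 + 'i%R * I2 = (I1 - - (k * 'i%R * (b' - b)%:C) * (a' - a)%:C) +
    'i%R * (I2 - k * (a' - a)%:C * (b' - b)%:C) by ring.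
apply: (le_trans (cabsD _ _)); rewrite cabsM cabs_i mul1r.
apply: (le_trans (lerD h1 h2)).
by rewrite le_eqVlt; apply/orP; left; apply/eqP; rewrite /D; ring.
Qed.

End goursat.

Lemma nested_itv (R : realType) (a b : nat -> R) :
  (forall n, a n <= a n.+1) -> (forall n, b n.+1 <= b n) ->
  (forall n, a n <= b n) -> exists x, forall n, a n <= x <= b n.
Proof.
move=> aS bS ab.
have ha : {homo a : m n / (m <= n)%N >-> m <= n} by apply: homo_leq => //; exact: le_trans.
have hb : {homo b : m n / (m <= n)%N >-> n <= m}.
  apply: (@homo_leq _ _ (fun x y => y <= x)) => //.
  by move=> y x z xy yz; exact: le_trans yz xy.
have ub m n : a m <= b n.
  apply: (@le_trans _ _ (a (maxn m n))); first by apply: ha; exact: leq_maxl.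
  apply: (@le_trans _ _ (b (maxn m n))); first exact: ab.
  by apply: hb; exact: leq_maxr.
have hs : has_sup (range a).
  by split; [exists (a 0), 0|exists (b 0) => _ [m _ <-]].
exists (sup (range a)) => n; apply/andP; split.
- by apply: sup_upper_bound => //; exists n.
- by apply: sup_le_ub => [|_ [m _ <-]]//; exists (a 0), 0.
Qed.

Lemma midpoint_itv (R : realType) (a b : R) : a <= b -> let m := (a + b) / 2 in
  [/\ a <= m, m <= b, m - a = (b - a) / 2 & b - m = (b - a) / 2].
Proof. by move=> ab; split; lra. Qed.

Lemma four_le (R : realType) (j j1 j2 j3 j4 : R) : j <= j1 + j2 + j3 + j4 ->
  4 * j1 <= j -> 4 * j2 <= j -> 4 * j3 <= j -> j <= 4 * j4.
Proof. lra. Qed.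

Section goursat_theorem.
Context {R : realType}.
Variable g : R[i] -> R[i].
Hypothesis gd : forall z, cdiff g z.

(** The order of the sides is bundled with the corners, so that choice yields a bisection map which
    can be iterated. *)
Record rectangle := Rectangle {
  left_ : R; right_ : R; bot_ : R; top_ : R;
  le_lr : left_ <= right_; le_bt : bot_ <= top_ }.

Let J (s : rectangle) := rect_int g (left_ s) (right_ s) (bot_ s) (top_ s).

Let quarter (s s' : rectangle) :=
  [/\ left_ s <= left_ s', right_ s' <= right_ s, bot_ s <= bot_ s' & top_ s' <= top_ s] /\
  [/\ right_ s' - left_ s' = (right_ s - left_ s) / 2,
      top_ s' - bot_ s' = (top_ s - bot_ s) / 2 &
      cabs (J s) <= 4 * cabs (J s')].

Let ex_quarter s : exists s', quarter s s'.
Proof.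
case: s => a a' b b' aa' bb'.
pose m := (a + a') / 2; pose n := (b + b') / 2.
have [am ma wl wr] := midpoint_itv aa'; have [bn nb hb ht] := midpoint_itv bb'.
rewrite -/m -/n in am ma wl wr bn nb hb ht.
pose s1 := Rectangle am bn; pose s2 := Rectangle ma bn.
pose s3 := Rectangle am nb; pose s4 := Rectangle ma nb.
have split4 : cabs (rect_int g a a' b b') <=
    cabs (J s1) + cabs (J s2) + cabs (J s3) + cabs (J s4).
  rewrite (rect_int_split gd am ma bn nb).
  by do 3! (apply: (le_trans (cabsD _ _)); rewrite lerD2r).
have [h1|h1] := leP (cabs (rect_int g a a' b b')) (4 * cabs (J s1)).
  by exists s1; split; split; [exact: lexx|exact: ma|exact: lexx|exact: nb|..].
have [h2|h2] := leP (cabs (rect_int g a a' b b')) (4 * cabs (J s2)).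
  by exists s2; split; split; [exact: am|exact: lexx|exact: lexx|exact: nb|..].
have [h3|h3] := leP (cabs (rect_int g a a' b b')) (4 * cabs (J s3)).
  by exists s3; split; split; [exact: lexx|exact: ma|exact: bn|exact: lexx|..].
have h4 := four_le split4 (ltW h1) (ltW h2) (ltW h3).
by exists s4; split; split; [exact: am|exact: lexx|exact: bn|exact: lexx|..].
Qed.

(** If the integral had modulus M > 0, bisection would leave at least M / 4^n on some rectangle of
    level n, while differentiability at the common point of these rectangles bounds it by 4 e D^2 /
    4^n with e arbitrary and D the half perimeter. *)
Theorem goursat a a' b b' : a <= a' -> b <= b' -> rect_int g a a' b b' = 0.
Proof.
move=> aa' bb'; apply/eqP; rewrite -cabs_eq0; apply/negP => /negP J0.
have [f fq] := choice ex_quarter.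
pose s n := iter n f (Rectangle aa' bb').
have sq n : quarter (s n) (s n.+1) by exact: fq.
have width n : right_ (s n) - left_ (s n) = (a' - a) / 2 ^+ n.
  elim: n => [|n IH]; first by rewrite expr0 divr1.
  by have [_ [-> _ _]] := sq n; rewrite IH exprSr invfM mulrA.
have height n : top_ (s n) - bot_ (s n) = (b' - b) / 2 ^+ n.
  elim: n => [|n IH]; first by rewrite expr0 divr1.
  by have [_ [_ -> _]] := sq n; rewrite IH exprSr invfM mulrA.
have big n : cabs (rect_int g a a' b b') <= 4 ^+ n * cabs (J (s n)).
  elim: n => [|n IH]; first by rewrite expr0 mul1r.
  apply: (le_trans IH); rewrite exprSr -mulrA ler_wpM2l ?exprn_ge0//.
  by have [_ []] := sq n.
have [x xs] : exists x, forall n, left_ (s n) <= x <= right_ (s n).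
  apply: nested_itv => n; last exact: le_lr.
  - by have [[]] := sq n.
  - by have [[]] := sq n.
have [y ys] : exists y, forall n, bot_ (s n) <= y <= top_ (s n).
  apply: nested_itv => n; last exact: le_bt.
  - by have [[]] := sq n.
  - by have [[]] := sq n.
have [k gk] := cdiffP (gd (x +i* y)).
set M := cabs _ in J0 big.
have M0 : 0 < M by rewrite lt_neqAle eq_sym J0 cabs_ge0.
pose D := (a' - a) + (b' - b).
have D0 : 0 <= D by rewrite /D; lra.
(* With this e the bound 4 e D^2 stays below M / 2; the added 1 covers the degenerate rectangle, D =
   0. *)
have e0 : 0 < M / (8 * (D ^+ 2 + 1)).
  by rewrite divr_gt0// mulr_gt0// ltr_wpDl// sqr_ge0.
have [r r0 gr] := gk _ e0.
have [n Dn] : exists n, D / 2 ^+ n < r.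
  exists (Num.bound (D / r)).
  rewrite ltr_pdivrMr ?exprn_gt0// mulrC -ltr_pdivrMr//.
  have Dr0 : 0 <= D / r by rewrite divr_ge0// ltW.
  apply: (lt_le_trans (archi_boundP Dr0)).
  rewrite -natrX ler_nat; exact: ltnW (ltn_expl _ _).
have := rect_int_near gd gr (ltW e0) (xs n) (ys n).
rewrite width height -mulrDl -/D => /(_ Dn) small.
have := le_trans (big n) (ler_wpM2l (exprn_ge0 n _) small).
rewrite ler0n => /(_ isT).
have -> : 4 ^+ n * (4 * (M / (8 * (D ^+ 2 + 1))) * (D / 2 ^+ n) ^+ 2) =
    M * (D ^+ 2 / (2 * (D ^+ 2 + 1))).
  have -> : (4 : R) ^+ n = (2 ^+ n) ^+ 2.
    by rewrite -exprM mulnC exprM; congr (_ ^+ _); ring.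
  have t0 : 2 ^+ n != 0 :> R by rewrite expf_neq0.
  have D1 : D ^+ 2 + 1 != 0 by rewrite gt_eqF// ltr_wpDl// sqr_ge0.
  by field; rewrite t0 D1.
apply/negP; rewrite -ltNge -[ltRHS]mulr1 ltr_pM2l//.
have D2 := sqr_ge0 D.
by rewrite ltr_pdivrMr; lra.
Qed.

End goursat_theorem.


(** * Exponential majorants and the shift of a horizontal contour *)

Section exp_abs.
Context {R : realType}.
Notation mu := (@lebesgue_measure R).

Lemma integral_expRN : (\int[mu]_(x in `[0%R, +oo[) (expR (- x))%:E = 1)%E.
Proof.
rewrite (@ge0_continuous_FTC2y _ (fun x => expR (- x)) (fun x => - expR (- x)) 0 0).
- by rewrite oppr0 expR0 sub0e EFinN oppeK.
- by move=> x _; exact: expR_ge0.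
- apply: continuous_subspaceT => x; apply: continuous_comp; first exact: opp_continuous.
  exact: continuous_expR.
- rewrite -oppr0; apply: cvgN; exact: cvgr_expR.
- by move=> x _; exact: ex_derive.
- apply: cvg_at_right_filter; apply: cvgN.
  by apply: continuous_comp; [exact: opp_continuous|exact: continuous_expR].
- move=> x _; rewrite derive1E.
  have dx : is_derive x (1 : R) (fun x => - expR (- x)) (expR (- x)).
    apply: is_derive_eq.
    by rewrite /GRing.scale/=; ring.
  exact: derive_val.
Qed.

(** This is the common majorant: every integrability proof below, on the line, on the half-line or
    in the radial variable, compares with a multiple of it. *)
Lemma integrable_expRN_abs : mu.-integrable setT (EFin \o (fun x => expR (- `|x|))).
Proof.
have ce : continuous (fun x : R => expR (- `|x|)).
  have cn : continuous (fun x : R => - `|x|).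
    by move=> x; apply: cvgN; exact: norm_continuous.
  by move=> x; exact: (cvg_comp _ _ (cn x) (@continuous_expR R (- `|x|))).
apply/integrableP; split.
  by apply/measurable_EFinP; exact: continuous_measurable_fun.
under eq_integral do rewrite /= ger0_norm ?expR_ge0//.
rewrite ge0_symfun_integralT//; last by move=> x /=; rewrite normrN.
rewrite -set_itvcy; under eq_integral => x.
  rewrite inE/= in_itv/= andbT => x0; rewrite ger0_norm//.
  over.
by rewrite integral_expRN mule1 ltry.
Qed.

End exp_abs.

Section contour_shift.
Context {R : realType}.
Notation mu := (@lebesgue_measure R).

Lemma cvg_Rintegral_itv (h : R -> R) : mu.-integrable setT (EFin \o h) ->
  (\int[mu]_(x in `[- n%:R, n%:R]) h x) @[n --> \oo] --> \int[mu]_x h x.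
Proof.
move=> hi; have mh : measurable_fun setT h by have /integrableP[/measurable_EFinP] := hi.
pose F (n : nat) : R -> \bar R := (EFin \o h) \_ `[- n%:R, n%:R].
have mF n : measurable_fun setT (F n).
  apply/(measurable_restrictT _ _).1; first exact: measurable_itv.
  by apply: measurable_funTS; exact/measurable_EFinP.
have Fh : \forall x \ae mu, setT x -> F n x @[n --> \oo] --> (h x)%:E.
  apply: aeW => x _; apply: cvg_near_cst; near=> n.
  rewrite /F patchE ifT// inE/= in_itv/= -ler_norml.
  by near: n; exact: nbhs_infty_ger.
have Fle : \forall x \ae mu, forall n, setT x -> (`|F n x| <= `|(h x)%:E|)%E.
  by apply: aeW => x n _; rewrite /F patchE; case: ifP => // _; rewrite abse0.
have [_ _] := @dominated_convergence _ _ _ mu setT measurableT F (EFin \o h)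
  (abse \o (EFin \o h)) mF (measurable_int _ hi) Fh (integrable_abse hi) Fle.
move=> lim; apply: fine_cvg; rewrite fineK; last exact: integrable_fin_num.
by under eq_fun do rewrite integral_mkcond.
Unshelve. all: by end_near. Qed.

(** Goursat's theorem on [-n, n] x [0, alpha]: the horizontal sides tend to the two integrals, and
    the vertical ones are O(e^{-n}). *)
Lemma contour_shift (g : R[i] -> R[i]) (C alpha : R) :
  (forall z, cdiff g z) -> 0 <= alpha -> 0 <= C ->
  (forall u b, 0 <= b <= alpha -> cabs (g (u +i* b)) <= C * expR (- `|u|)) ->
  cintegral mu setT (fun u => g (u +i* 0)) =
  cintegral mu setT (fun u => g (u +i* alpha)).
Proof.
move=> gd alpha0 C0 gC.
have gi b : 0 <= b <= alpha -> cintegrable mu setT (fun u => g (u +i* b)).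
  move=> bb; have cg := ccont_hline gd b.
  apply: (@cintegrable_le _ (measurableTypeR R) R mu setT measurableT _ (fun u => C * expR (- `|u|))).
  - by apply: continuous_measurable_fun => x; have [] := cg x.
  - by apply: continuous_measurable_fun => x; have [] := cg x.
  - by apply: eq_integrable (@integrableZl _ (measurableTypeR R) R mu setT measurableT C _ integrable_expRN_abs).
  - by move=> u _; exact: gC.
have i0 : 0 <= (0 : R) <= alpha by rewrite lexx.
have ia : 0 <= alpha <= alpha by rewrite lexx andbT.
apply/eqP; rewrite -subr_eq0 -(@cintegralB _ (measurableTypeR R))//; [|exact: gi|exact: gi].
set f := fun u => _; have cf : ccont f.
  move=> x; apply: ccont_atD; first exact: ccont_hline.
  by apply: ccont_atN; exact: ccont_hline.
have fi : cintegrable mu setT f by apply: cintegrableB => //; exact: gi.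
have bound n : cabs (seg_int f (- n%:R) n%:R) <= 4 * C * alpha * expR (- n%:R).
  have n0 : - n%:R <= n%:R :> R by rewrite (@le_trans _ _ 0)// oppr_le0.
  have := goursat gd n0 alpha0; rewrite /rect_int -/f => /eqP.
  rewrite addr_eq0 => /eqP ->; rewrite cabsN cabsM cabs_i mul1r.
  set v := fun y => _.
  have vc : ccont v.
    move=> x; apply: ccont_atD; first exact: ccont_vline.
    by apply: ccont_atN; exact: ccont_vline.
  have : cabs (seg_int v 0 alpha - 0 * (alpha - 0)%:C) <= 2 * (2 * C * expR (- n%:R) * (alpha - 0)).
    apply: cabs_seg_int_sub => // y ya; rewrite subr0.
    apply: (le_trans (cabsB _ _)); rewrite -mulrA mulr_natl mulr2n lerD//.
    - by apply: (le_trans (gC _ _ ya)); rewrite ger0_norm.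
    - by apply: (le_trans (gC _ _ ya)); rewrite normrN ger0_norm.
  rewrite mul0r !subr0 => /le_trans; apply.
  by rewrite le_eqVlt; apply/orP; left; apply/eqP; ring.
have lim0 : 4 * C * alpha * expR (- n%:R) @[n --> \oo] --> (0 : R).
  rewrite -(mulr0 (4 * C * alpha)); apply: cvgMr.
  exact: (@cvg_comp _ _ _ (fun n : nat => n%:R) (fun x : R => expR (- x)) _ _ _ cvgr_idn (@cvgr_expR R)).
apply/eqP/complex_ext => /=.
- apply: (@cvg_unique _ _ _ _ _ _ (cvg_Rintegral_itv fi.1)) => //.
  apply/norm_cvg0P; apply: (@squeeze_cvgr _ _ _ _ (cst 0) _ _ _ _ _ lim0); last exact: cvg_cst.
  apply: nearW => n; rewrite normr_ge0/= (le_trans _ (bound n))//.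
  exact: (norm_Re_le_cabs (seg_int f _ _)).
- apply: (@cvg_unique _ _ _ _ _ _ (cvg_Rintegral_itv fi.2)) => //.
  apply/norm_cvg0P; apply: (@squeeze_cvgr _ _ _ _ (cst 0) _ _ _ _ _ lim0); last exact: cvg_cst.
  apply: nearW => n; rewrite normr_ge0/= (le_trans _ (bound n))//.
  exact: (norm_Im_le_cabs (seg_int f _ _)).
Qed.

End contour_shift.

(** * The function Lambda *)

Section Lambda_entire.
Context {R : realType}.
Notation mu := (@lebesgue_measure R).
Implicit Types (z h : R[i]) (s : R).

Let D : set R := [set s | 0 <= s].

Let mD : measurable (D : set (measurableTypeR R)).
Proof. by rewrite /D -set_itvcy; exact: measurable_itv. Qed.

Let E z s : R[i] := cexp (- (s ^+ 2)%:C - 2%:R * z * s%:C).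

Let N : R := \int[mu]_(s in D) expR (- `|s|).

Let iexp : mu.-integrable D (EFin \o (fun s => expR (- `|s|))).
Proof. exact: integrableS integrable_expRN_abs. Qed.

Let N0 : 0 <= N.
Proof. by apply: Rintegral_ge0 => s _; exact: expR_ge0. Qed.

Let ccont_E z : ccont (E z).
Proof.
move=> s; apply: ccont_at_cexp; apply: ccont_atD.
  by apply: ccont_atN; apply: ccont_at_real; exact: exprn_continuous.
apply: ccont_atN; apply: ccont_atM; first exact: ccont_at_cst.
by apply: ccont_at_real; exact: cvg_id.
Qed.

(** Completing the square in - s^2 + (2 |z| + k + 1) s; the 1 pays for the factor e^{-s} on the
    right. *)
Let cabs_E z (k : R) s : 0 <= s ->
  cabs (E z s) * expR (k * s) <= expR ((cabs z + (k + 1) / 2) ^+ 2) * expR (- `|s|).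
Proof.
move=> s0; rewrite cabs_cexp -!expRD ler_expR (ger0_norm s0).
have -> : complex.Re (- (s ^+ 2)%:C - 2%:R * z * s%:C) =
    - s ^+ 2 - 2 * complex.Re z * s.
  by case: z => x y; rewrite ReD !ReN !ReM !ImM /=; ring.
have := norm_Re_le_cabs z; rewrite ler_norml => /andP[h1 _].
have h2 : - complex.Re z * s <= cabs z * s by rewrite ler_wpM2r//; lra.
have := sqr_ge0 (s - (cabs z + (k + 1) / 2)); nra.
Qed.

(** The weight p is 1 for [Lambda] itself, -2s for its derivative, and the Taylor remainder of the
    exponential for the error of the difference quotient. *)
Let cintegrable_E (p : R -> R[i]) z (k K : R) : ccont p -> 0 <= K ->
  (forall s, 0 <= s -> cabs (p s) <= K * expR (k * s)) ->
  cintegrable mu D (fun s => p s * E z s) /\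
  cabs (cintegral mu D (fun s => p s * E z s)) <=
    2 * (K * expR ((cabs z + (k + 1) / 2) ^+ 2) * N).
Proof.
move=> cp K0 pK; pose B := K * expR ((cabs z + (k + 1) / 2) ^+ 2).
have le s : D s -> cabs (p s * E z s) <= B * expR (- `|s|).
  move=> s0; rewrite cabsM mulrC /B -mulrA.
  apply: (@le_trans _ _ (cabs (E z s) * (K * expR (k * s)))).
    by apply: ler_wpM2l; [exact: cabs_ge0|exact: pK].
  by rewrite mulrCA ler_wpM2l// cabs_E.
have c s : ccont_at (fun s => p s * E z s) s by apply: ccont_atM; [exact: cp|exact: ccont_E].
have iB : mu.-integrable D (EFin \o (fun s => B * expR (- `|s|))).
  by apply: eq_integrable (integrableZl mD B iexp).
have ci : cintegrable mu D (fun s => p s * E z s).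
  apply: (cintegrable_le mD _ _ iB le).
  - by apply: measurable_funTS; apply: continuous_measurable_fun => s; have [] := c s.
  - by apply: measurable_funTS; apply: continuous_measurable_fun => s; have [] := c s.
split => //; apply: (le_trans (cabs_cintegral_le mD ci iB le)).
by rewrite RintegralZl.
Qed.

Let c0 : R[i] := (2 / Num.sqrt pi)%:C.

Let LambdaE z : Lambda z = c0 * cintegral mu D (fun s => 1 * E z s).
Proof.
by congr (_ * _); apply: eq_cintegral => s _; rewrite mul1r.
Qed.

Let cabs1_le s : 0 <= s -> cabs (1 : R[i]) <= 1 * expR (0 * s).
Proof. by rewrite cabs1 mul0r expR0 mulr1. Qed.

(** An exponent quadratic in |z| is harmless: in the kernel |z|^2 is O(|w|), whereas the Gaussian
    decays quadratically in |w|. *)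
Lemma Lambda_bound : exists2 C : R, 0 <= C &
  forall z, cabs (Lambda z) <= C * expR (2 * cabs z ^+ 2).
Proof.
exists (cabs c0 * (2 * (expR (1 / 2) * N))) => [|z].
  by rewrite !mulr_ge0// ?cabs_ge0.
have [_ h] := @cintegrable_E (fun=> 1) z 0 1 (fun s => ccont_at_cst _ s) ler01 cabs1_le.
rewrite LambdaE cabsM -mulrA ler_wpM2l ?cabs_ge0//; apply: (le_trans h).
(* This is (a + 1/2)^2 <= 2 a^2 + 1/2 with a = |z|. *)
have hX : expR ((cabs z + (0 + 1) / 2) ^+ 2) <= expR (1 / 2) * expR (2 * cabs z ^+ 2).
  by rewrite -expRD ler_expR; have := sqr_ge0 (cabs z - 1 / 2); nra.
by have := ler_wpM2r N0 hX; lra.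
Qed.

(** Differentiation under the integral sign: changing z by h multiplies the integrand by e^{hq} with
    q = -2s, and the remainder e^{hq} - 1 - hq is O(|h|^2 e^{3s}) for |h| <= 1. *)
Lemma cdiff_Lambda z : cdiff (@Lambda R) z.
Proof.
pose q s : R[i] := - 2%:R * s%:C.
have cq : ccont q.
  move=> s; apply: ccont_atM; first exact: ccont_at_cst.
  by apply: ccont_at_real; exact: cvg_id.
have [iE _] := @cintegrable_E (fun=> 1) z 0 1 (fun s => ccont_at_cst _ s) ler01 cabs1_le.
have cabs_q s : 0 <= s -> cabs (q s) = 2 * s.
  move=> s0; rewrite /q mulNr cabsN -(rmorph_nat (real_complex R)) -rmorphM.
  by rewrite cabs_real ger0_norm// mulr_ge0.
have qK s : 0 <= s -> cabs (q s) <= 2 * expR (1 * s).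
  by move=> s0; rewrite cabs_q// mul1r; have := expR_ge1Dx s; lra.
have [iq _] := @cintegrable_E q z 1 2 cq (ler0n _ 2) qK.
pose a := c0 * cintegral mu D (fun s => q s * E z s).
apply: (@cdiff_quadratic _ _ _ a (cabs c0 * (2 * (64 * expR ((cabs z + (3 + 1) / 2) ^+ 2) * N)))) => h h1.
have [iEh _] := @cintegrable_E (fun=> 1) (z + h) 0 1 (fun s => ccont_at_cst _ s) ler01 cabs1_le.
pose p s := cexp (h * q s) - 1 - h * q s.
have chq : ccont (fun s => h * q s).
  by move=> s; apply: ccont_atM; [exact: ccont_at_cst|exact: cq].
have cp : ccont p.
  move=> s; apply: ccont_atD; last exact: ccont_atN.
  apply: ccont_atD; first exact: ccont_at_cexp.
  by apply: ccont_atN; exact: ccont_at_cst.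
have -> : Lambda (z + h) - Lambda z - a * h = c0 * cintegral mu D (fun s => p s * E z s).
  rewrite !LambdaE /a -!mulrA -!mulrBr [_ * h]mulrC; congr (_ * _).
  rewrite -cintegralB// -cintegralZ// -cintegralB//; last exact: cintegrableZ.
    apply: eq_cintegral => s _; rewrite /p.
    have -> : E (z + h) s = cexp (h * q s) * E z s.
      by rewrite -cexpD /E /q; congr cexp; ring.
    ring.
  exact: cintegrableB.
rewrite cabsM -mulrA ler_wpM2l ?cabs_ge0//.
(* 64 = 4 * 4 * 4, from the exponential remainder, from (2s)^2 = 4 s^2 and from s^2 <= 4 e^s. The
   exponent 3s adds this e^s to e^{|hq|} <= e^{2s}. *)
have pK s : 0 <= s -> cabs (p s) <= 64 * cabs h ^+ 2 * expR (3 * s).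
  move=> s0; apply: (le_trans (cexp_sub1_bound _)).
  rewrite cabsM cabs_q//; have c0' := cabs_ge0 h.
  have e1 : expR (cabs h * (2 * s)) <= expR (2 * s) by rewrite ler_expR; nra.
  have e2 : s ^+ 2 <= 4 * expR s.
    have es : expR s = expR (s / 2) * expR (s / 2) by rewrite -expRD -splitr.
    by have := expR_ge1Dx (s / 2); rewrite es; nra.
  have -> : expR (3 * s) = expR s * expR (2 * s) by rewrite -expRD; congr expR; ring.
  have -> : 64 * cabs h ^+ 2 * (expR s * expR (2 * s)) =
    16 * cabs h ^+ 2 * (4 * expR s) * expR (2 * s) by ring.
  apply: ler_pM => //.
    by rewrite mulr_ge0// exprn_ge0// mulr_ge0// mulr_ge0.
  rewrite exprMn [(2 * s) ^+ 2]exprMn.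
  have -> : 4 * (cabs h ^+ 2 * (2 ^+ 2 * s ^+ 2)) = 16 * cabs h ^+ 2 * s ^+ 2 by ring.
  by rewrite ler_wpM2l// mulr_ge0// exprn_ge0.
have [] := @cintegrable_E p z 3 (64 * cabs h ^+ 2) cp _ pK.
  by rewrite mulr_ge0// exprn_ge0// cabs_ge0.
move=> _ /le_trans; apply.
by rewrite le_eqVlt; apply/orP; left; apply/eqP; ring.
Qed.

End Lambda_entire.

(** * Integration over the polar domain *)

Section transfer.
Context {R : realType}.
Notation mu := (@lebesgue_measure R).
Local Open Scope ereal_scope.

Let J : set R := `](- (pi / 2))%R, (3%:R * pi / 2)%R[%classic.
Let pos : set R := `]0%R, +oo[%classic.

Lemma rot_domainE : @rot_domain R = pos `*` J.
Proof.
by apply/seteqP; split=> -[r q]; rewrite /rot_domain /pos /J /= !in_itv/= andbT.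
Qed.

Lemma measurable_rot_domain : measurable (@rot_domain R).
Proof. by rewrite rot_domainE; apply: measurableX; exact: measurable_itv. Qed.

Lemma measurable_polar : measurable_fun setT
  (fun p : R * R => (p.1 * cos p.2, p.1 * sin p.2)%R).
Proof.
have mc : measurable_fun setT (@cos R).
  by apply: continuous_measurable_fun => x; exact: continuous_cos.
have ms : measurable_fun setT (@sin R).
  by apply: continuous_measurable_fun => x; exact: continuous_sin.
by apply: measurable_fun_pair; apply: measurable_funM => //;
  apply: measurableT_comp => //; exact: measurable_snd.
Qed.

Lemma ge0_integral_rot_domain (h : R * R -> \bar R) :
  measurable_fun setT h -> (forall p, @rot_domain R p -> 0 <= h p) ->
  \int[@leb2 R]_(p in @rot_domain R) h p = \int[mu]_(q in J) \int[mu]_(r in pos) h (r, q).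
Proof.
move=> mh h0; rewrite integral_mkcond.
have m1 : measurable_fun setT (h \_ (@rot_domain R)).
  apply/(measurable_restrictT _ _).1; first exact: measurable_rot_domain.
  exact: measurable_funTS.
have p1 p : 0 <= (h \_ (@rot_domain R)) p.
  by rewrite patchE; case: ifPn => //; rewrite inE => /h0.
rewrite (@fubini_tonelli2 _ _ _ _ _ mu mu _ m1 p1) [RHS]integral_mkcond.
apply: eq_integral => q _; rewrite patchE; case: ifPn => qJ; last first.
  apply: integral0_eq => r _; rewrite patchE rot_domainE; case: ifPn => //.
  rewrite inE => -[_ /= qJ']; move/negP : qJ; rewrite inE; contradiction.
rewrite [RHS]integral_mkcond; apply: eq_integral => r _; rewrite !patchE.
have -> // : ((r, q) \in @rot_domain R) = (r \in pos).
rewrite rot_domainE; apply/idP/idP; rewrite !inE; first by case.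
by split => //=; move: qJ; rewrite inE.
Qed.

Lemma ge0_integral_polar_rot (g : R * R -> \bar R) :
  measurable_fun setT g -> (forall y, 0 <= g y) ->
  \int[@leb2 R]_y g y =
  \int[@leb2 R]_(p in @rot_domain R) (g (p.1 * cos p.2, p.1 * sin p.2)%R * p.1%:E).
Proof.
move=> mg g0; rewrite ge0_integral_rot_domain.
- exact: ge0_integral_polar.
- apply: emeasurable_funM; last by apply/measurable_EFinP; exact: measurable_fst.
  exact: (measurableT_comp mg measurable_polar).
- by move=> p [/ltW p0 _]; rewrite mule_ge0// lee_fin.
Qed.

(** The nonnegative case applied to the positive and negative parts, which the Jacobian [p.1] > 0
    preserves. *)
Lemma integral_polar_rot (g : R * R -> R) : measurable_fun setT g ->
  \int[@leb2 R]_y (g y)%:E =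
  \int[@leb2 R]_(p in @rot_domain R) (g (p.1 * cos p.2, p.1 * sin p.2) * p.1)%R%:E.
Proof.
move=> mg; have mE : measurable_fun setT (EFin \o g) by exact/measurable_EFinP.
rewrite [LHS]integralE [RHS]integralE.
rewrite ge0_integral_polar_rot//; last exact: measurable_funepos.
rewrite (@ge0_integral_polar_rot (fun y => (EFin \o g)^\- y))//; last exact: measurable_funeneg.
congr (_ - _); apply: eq_integral => p; rewrite inE => -[/ltW p0 _];
  rewrite ?funeposE ?funenegE /= -?EFin_max -?EFinM; congr EFin.
- by rewrite maxr_pMl// mul0r.
- by rewrite maxr_pMl// mul0r mulNr.
Qed.

Lemma integrable_polar_rot (g : R * R -> R) : measurable_fun setT g ->
  (@leb2 R).-integrable (@rot_domain R)
    (fun p => (g (p.1 * cos p.2, p.1 * sin p.2) * p.1)%R%:E) ->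
  (@leb2 R).-integrable setT (EFin \o g).
Proof.
move=> mg /integrableP[_ gi]; apply/integrableP; split; first exact/measurable_EFinP.
rewrite (@ge0_integral_polar_rot (fun y => `|(EFin \o g) y|)); last 2 first.
- by apply: measurableT_comp => //; exact/measurable_EFinP.
- by move=> y; exact: abse_ge0.
apply: le_lt_trans gi; rewrite le_eqVlt; apply/orP; left; apply/eqP.
apply: eq_integral => p; rewrite inE => -[p0 _] /=.
by rewrite normrM (gtr0_norm p0) EFinM.
Qed.

Lemma integral_exp (f : R -> R) : measurable_fun setT f ->
  \int[mu]_(x in pos) (f x)%:E = \int[mu]_u (f (expR u) * expR u)%R%:E.
Proof.
move=> mf; have mE : measurable_fun setT (EFin \o f) by exact/measurable_EFinP.
rewrite [LHS]integralE [RHS]integralE.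
rewrite ge0_integral_exp//; last exact: measurable_funepos.
rewrite (@ge0_integral_exp _ (fun y => (EFin \o f)^\- y))//; last exact: measurable_funeneg.
congr (_ - _); apply: eq_integral => u _; have := expR_ge0 u => u0;
  rewrite ?funeposE ?funenegE /= -?EFin_max -?EFinM; congr EFin.
- by rewrite maxr_pMl// mul0r.
- by rewrite maxr_pMl// mul0r mulNr.
Qed.

(** Fubini's theorem in the form needed for the rotation: h will be the difference of the two sides,
    whose integral along each ray vanishes. *)
Lemma integral_rot_domain_eq0 (h : R * R -> R) :
  (@leb2 R).-integrable (@rot_domain R) (EFin \o h) ->
  (forall q, J q -> \int[mu]_(r in pos) (h (r, q))%:E = 0) ->
  \int[@leb2 R]_(p in @rot_domain R) (h p)%:E = 0.
Proof.
move=> hi h0; rewrite integral_mkcond.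
have hi' : (@leb2 R).-integrable setT ((EFin \o h) \_ (@rot_domain R)).
  by apply/integrable_restrict; rewrite ?setTI//; exact: measurable_rot_domain.
rewrite -(integral21_prod_meas1 hi'); apply: integral0_eq => q _.
rewrite /fubini_G; have [qJ|qJ] := boolP (q \in J); last first.
  apply: integral0_eq => r _; rewrite patchE rot_domainE; case: ifPn => //.
  rewrite inE => -[_ /= qJ']; move/negP : qJ; rewrite inE; contradiction.
rewrite -[RHS](h0 q); last by move: qJ; rewrite inE.
rewrite [RHS]integral_mkcond; apply: eq_integral => r _; rewrite !patchE.
have -> // : ((r, q) \in @rot_domain R) = (r \in pos).
rewrite rot_domainE; apply/idP/idP; rewrite !inE; first by case.
by split => //=; move: qJ; rewrite inE.
Qed.

(** The angle ranges over a bounded interval, so a radial majorant is enough. *)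
Lemma integrable_rot_domain_expRN (K : R) :
  (@leb2 R).-integrable (@rot_domain R) (EFin \o (fun p => K * expR (- `|p.1|))%R).
Proof.
have mh : measurable_fun setT (fun p : R * R => (K * expR (- `|p.1|))%R).
  apply: measurable_funM => //; apply: measurableT_comp; first exact: measurable_expR.
  by apply: measurableT_comp => //; apply: measurableT_comp => //; exact: measurable_fst.
apply/integrableP; split; first by apply/measurable_EFinP; exact: measurable_funTS.
rewrite (@ge0_integral_rot_domain (fun p => `|(K * expR (- `|p.1|))%:E|)); first last.
- by move=> p _; exact: abse_ge0.
- by apply: measurableT_comp => //; exact/measurable_EFinP.
have iK := @integrableZl _ (measurableTypeR R) R mu setT measurableT K _ (@integrable_expRN_abs R).
have /integrableP[_] : mu.-integrable pos (fun x => K%:E * (EFin \o (fun x => expR (- `|x|))) x).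
  by apply: integrableS iK => //; exact: measurable_itv.
set c := integral _ _ _ => c_fin.
have c0 : 0 <= c by apply: integral_ge0 => r _; exact: abse_ge0.
rewrite (eq_integral (cst c)); last by move=> q _ /=; apply: eq_integral => r _.
rewrite integral_cst; last exact: measurable_itv.
rewrite lte_mul_pinfty ?ge0_fin_numE//.
by rewrite /= /J lebesgue_measure_itv/=; case: ifP; rewrite ltry.
Qed.

End transfer.

(** * The kernel *)

Section kernel.
Context {R : realType}.
Implicit Types (u v w z : R[i]) (s : R).

(** Both sides have the same square, hence agree up to sign, and both have nonnegative real part. *)
Lemma csqrt_sqr (r : R) v : 0 <= r -> 0 < complex.Re v ->
  csqrt (r%:C * v ^+ 2) = (Num.sqrt r)%:C * v.
Proof.
move=> r0 v0; set z := r%:C * _; set y := _ * v.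
have e : csqrt z ^+ 2 = y ^+ 2.
  by rewrite sqr_sqrtc /y exprMn -rmorphXn sqr_sqrtr.
move: e => /eqP; rewrite eqf_sqr => /orP[/eqP //|/eqP e].
have h1 : 0 <= complex.Re (csqrt z).
  by rewrite /csqrt /sqrtc; case: (z) => a b /=; exact: sqrtr_ge0.
have h2 : complex.Re y = Num.sqrt r * complex.Re v.
  by rewrite /y ReM /= mul0r subr0.
(* Opposite signs are possible only if both real parts vanish, which for Re v > 0 means r = 0. *)
have s0 : Num.sqrt r = 0.
  move: h1; rewrite e ReN h2 oppr_ge0 => h1.
  apply/eqP; rewrite eq_le sqrtr_ge0 andbT; move: h1; rewrite pmulr_lle0//.
by rewrite e /y s0 mul0r oppr0.
Qed.

Lemma cabs_sub1_cexp z : cabs (cexp z - 1) <= 4 * cabs z * expR (2 * cabs z).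
Proof.
have -> : cexp z - 1 = (cexp z - 1 - z) + z by rewrite subrK.
apply: (le_trans (cabsD _ _)); have h := cexp_sub1_bound z.
have z0 := cabs_ge0 z; have e1 := expR_ge1Dx (cabs z).
have -> : expR (2 * cabs z) = expR (cabs z) * expR (cabs z).
  by rewrite -expRD; congr expR; ring.
set E := expR _ in h e1 *.
have hE : 4 * cabs z ^+ 2 * E + cabs z <= 4 * cabs z * (E * E).
  have -> : 4 * cabs z * (E * E) = cabs z * (4 * (E * E)) by ring.
  have -> : 4 * cabs z ^+ 2 * E + cabs z = cabs z * (4 * cabs z * E + 1) by ring.
  by rewrite ler_wpM2l//; nra.
by lra.
Qed.

Lemma entire2_cont (F : R[i] * R[i] -> R[i]) (z : R[i] * R[i]) : entire2 F ->
  forall e, 0 < e -> exists2 d, 0 < d & forall h, cabs2 h < d ->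
    cabs (F (z.1 + h.1, z.2 + h.2) - F z) < e.
Proof.
move=> /(_ z)[a [b Fab]] e e0; have [d d0 Fd] := Fab 1 ltr01.
have K0 : 0 < 1 + cabs a + cabs b by rewrite -addrA ltr_pwDl// addr_ge0// cabs_ge0.
exists (Num.min d (e / (1 + cabs a + cabs b))); first by rewrite lt_min d0 divr_gt0.
move=> h; rewrite lt_min => /andP[/Fd h1]; rewrite ltr_pdivlMr// => h2.
have -> : F (z.1 + h.1, z.2 + h.2) - F z =
  (F (z.1 + h.1, z.2 + h.2) - F z - a * h.1 - b * h.2) + (a * h.1 + b * h.2) by ring.
have n1 : cabs h.1 <= cabs2 h.
  by rewrite /cabs2 -[leLHS]ger0_norm ?cabs_ge0// -sqrtr_sqr ler_wsqrtr// lerDl sqr_ge0.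
have n2 : cabs h.2 <= cabs2 h.
  by rewrite /cabs2 -[leLHS]ger0_norm ?cabs_ge0// -sqrtr_sqr ler_wsqrtr// lerDr sqr_ge0.
apply: (le_lt_trans (cabsD _ _)); apply: le_lt_trans h2.
have := cabsD (a * h.1) (b * h.2); rewrite !cabsM.
have := ler_wpM2l (cabs_ge0 a) n1; have := ler_wpM2l (cabs_ge0 b) n2.
lra.
Qed.

Lemma ccont_at_entire2 {T : topologicalType} (F : R[i] * R[i] -> R[i])
    (f g : T -> R[i]) x : entire2 F -> ccont_at f x -> ccont_at g x ->
  ccont_at (fun y => F (f y, g y)) x.
Proof.
move=> /entire2_cont Fc /ccont_atP cf /ccont_atP cg; apply/ccont_atP => e e0.
have [d d0 Fd] := Fc (f x, g x) _ e0.
have d20 : 0 < d / 2 by rewrite divr_gt0.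
near=> y; have := Fd (f y - f x, g y - g x); rewrite /= [f x + _]addrC [g x + _]addrC !subrK; apply.
rewrite /cabs2 /= -(@ltr_pXn2r _ 2) ?nnegrE ?sqrtr_ge0 ?(ltW d0)//.
rewrite sqr_sqrtr ?addr_ge0 ?sqr_ge0//.
have h1 : cabs (f y - f x) < d / 2 by near: y; exact: cf.
have h2 : cabs (g y - g x) < d / 2 by near: y; exact: cg.
have := cabs_ge0 (f y - f x); have := cabs_ge0 (g y - g x); nra.
Unshelve. all: by end_near. Qed.

(** On the complex line spanned by a real unit vector the increment (h a, h b) has norm |h|, so the
    remainder estimate of F carries over unchanged. *)
Lemma cdiff_entire2 (F : R[i] * R[i] -> R[i]) (a b : R) z : entire2 F ->
  a ^+ 2 + b ^+ 2 = 1 -> cdiff (fun w => F (w * a%:C, w * b%:C)) z.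
Proof.
move=> /(_ (z * a%:C, z * b%:C))[p [q Fpq]] ab.
apply: (@cdiff_lim _ _ _ (p * a%:C + q * b%:C)) => e e0.
have [d d0 Fd] := Fpq _ e0; exists d => // h hd.
have hn : cabs2 (h * a%:C, h * b%:C) = cabs h.
  rewrite /cabs2 /= !cabsM !cabs_real !exprMn !real_normK ?num_real// -mulrDr ab mulr1.
  by rewrite sqrtr_sqr ger0_norm// cabs_ge0.
have := Fd (h * a%:C, h * b%:C); rewrite hn => /(_ hd) /=.
rewrite -!mulrDl; set X := F _; set Y := F _.
have -> // : X - Y - (p * a%:C + q * b%:C) * h = X - Y - p * (h * a%:C) - q * (h * b%:C).
by ring.
Qed.

Section kernel_def.
Variables (bc : BC) (F : R[i] * R[i] -> R[i]) (t r phi : R).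
Hypotheses (FA : A1 F) (t0 : 0 < t) (r0 : 0 <= r).

(* The integrand in the variable [v] with [v ^+ 2 = w], in which it is entire. *)
Definition kernel (eps theta : R) (v : R[i]) : R[i] :=
  cexp (- eps%:C * v ^+ 4) *
  (cexp (- (r%:C + v ^+ 2) ^+ 2 / (4%:R * 'i * t%:C)) / (8%:R * 'i * pi%:C * t%:C) *
   (Lambda ((Num.sqrt r)%:C * v * (cos ((phi - theta) / 2))%:C / csqrt ('i * t%:C))
    + bc_sign R bc *
      Lambda (- ((Num.sqrt r)%:C * v * (sin ((phi + theta) / 2))%:C) / csqrt ('i * t%:C)))) *
  F (v ^+ 2 * (cos theta)%:C, v ^+ 2 * (sin theta)%:C).

Lemma kernel_Gfun eps theta v : 0 < complex.Re v ->
  kernel eps theta v = cexp (- eps%:C * v ^+ 4) * Gfun bc t r phi (v ^+ 2) theta *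
    F (v ^+ 2 * (cos theta)%:C, v ^+ 2 * (sin theta)%:C).
Proof. by move=> v0; rewrite /kernel /Gfun csqrt_sqr. Qed.

Lemma kernel_eps eps theta v :
  kernel eps theta v = cexp (- eps%:C * v ^+ 4) * kernel 0 theta v.
Proof. by rewrite /kernel oppr0 mul0r cexp0 mul1r !mulrA. Qed.

Lemma cdiff_kernel eps theta v : cdiff (kernel eps theta) v.
Proof.
have dX n x : cdiff (fun v : R[i] => v ^+ n) x by apply: cdiffX; exact: cdiff_id.
have dL (a : R[i]) x : cdiff (fun v => Lambda (a * v)) x.
  apply: (cdiff_comp (f := @Lambda R)); last exact: cdiff_Lambda.
  by apply: cdiffZ; exact: cdiff_id.
apply: cdiffM; last first.
  apply: (cdiff_comp (g := fun v => v ^+ 2)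
    (f := fun w => F (w * (cos theta)%:C, w * (sin theta)%:C))) => //.
  by apply: cdiff_entire2; [case: FA|exact: cos2Dsin2].
apply: cdiffM.
  apply: (cdiff_comp (f := @cexp R)); last exact: cdiff_cexp.
  by apply: cdiffZ; exact: dX.
apply: cdiffM.
  apply: cdiffM; last exact: cdiff_cst.
  apply: (cdiff_comp (f := @cexp R)); last exact: cdiff_cexp.
  apply: (@cdiff_ext _ (fun v => (- (4%:R * 'i * t%:C)^-1) * (r%:C + v ^+ 2) ^+ 2)).
    by move=> x; ring.
  apply: cdiffZ; apply: (cdiffX (f := fun v => r%:C + v ^+ 2)).
  by apply: cdiffD; [exact: cdiff_cst|exact: dX].
apply: cdiffD.
  apply: cdiff_ext (dL ((Num.sqrt r)%:C * (cos ((phi - theta) / 2))%:C / csqrt ('i * t%:C)) v).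
  by move=> x; congr Lambda; ring.
apply: cdiffZ.
apply: cdiff_ext (dL (- ((Num.sqrt r)%:C * (sin ((phi + theta) / 2))%:C) / csqrt ('i * t%:C)) v).
by move=> x; congr Lambda; ring.
Qed.

(** Joint continuity in angle and v, from which measurability on the product follows; [cdiff_kernel]
    concerns one fixed angle. *)
Lemma ccont_kernel {T : topologicalType} eps (th : T -> R) (f : T -> R[i]) x :
  {for x, continuous th} -> ccont_at f x ->
  ccont_at (fun y => kernel eps (th y) (f y)) x.
Proof.
move=> cth cf.
have cX n : ccont_at (fun y => f y ^+ n) x.
  apply: (@cdiff_ccont _ _ (fun v => v ^+ n) f) => //.
  by apply: cdiffX; exact: cdiff_id.
have cc (h : R -> R) : continuous h -> ccont_at (fun y => (h (th y))%:C) x.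
  by move=> ch; apply: ccont_at_real; exact: (continuous_comp cth (ch _)).
have cL (g : T -> R[i]) : ccont_at g x -> ccont_at (fun y => Lambda (g y)) x.
  by move=> cg; apply: (@cdiff_ccont _ _ (@Lambda R) g) => //; exact: cdiff_Lambda.
apply: ccont_atM; last first.
  apply: ccont_at_entire2; first by case: FA.
  - by apply: ccont_atM => //; apply: cc; exact: continuous_cos.
  - by apply: ccont_atM => //; apply: cc; exact: continuous_sin.
have cst c : ccont_at (fun=> c : R[i]) x by exact: ccont_at_cst.
apply: ccont_atM; first by apply: ccont_at_cexp; exact: ccont_atM.
apply: ccont_atM.
  apply: ccont_atM => //; apply: ccont_at_cexp; apply: ccont_atM => //.
  apply: ccont_atN; rewrite /=.
  apply: (@cdiff_ccont _ _ (fun v => v ^+ 2) (fun y => r%:C + f y ^+ 2)).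
    by apply: cdiffX; exact: cdiff_id.
  exact: ccont_atD.
have cq (h : R -> R) : continuous h -> ccont_at (fun y => (Num.sqrt r)%:C * f y * (h (th y))%:C) x.
  by move=> ch; apply: ccont_atM; [exact: ccont_atM|exact: cc].
apply: ccont_atD.
  apply: cL; apply: ccont_atM => //; apply: (cq (fun q => cos ((phi - q) / 2))).
  move=> q; apply: continuous_comp; last exact: continuous_cos.
  by apply: cvgMl; apply: cvgB; [exact: cvg_cst|exact: cvg_id].
apply: ccont_atM => //; apply: cL; apply: ccont_atM => //; apply: ccont_atN.
apply: (cq (fun q => sin ((phi + q) / 2))).
move=> q; apply: continuous_comp; last exact: continuous_sin.
by apply: cvgMl; apply: cvgD; [exact: cvg_cst|exact: cvg_id].
Qed.

End kernel_def.
End kernel.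

(** * Growth of the kernel in the upper half-plane *)

Section kernel_bound.
Context {R : realType}.
Variables (bc : BC) (F : R[i] * R[i] -> R[i]) (t r phi : R).
Hypotheses (FA : A1 F) (t0 : 0 < t) (r0 : 0 <= r).

Lemma cabs_csqrt_it : cabs (csqrt ('i%R * t%:C)) ^+ 2 = t.
Proof. by rewrite -cabsX sqr_sqrtc cabsM cabs_i mul1r cabs_real gtr0_norm. Qed.

(** The real part is - Im ((r + w)^2) / (4 t), and the cross term 2 r Im w is nonnegative in the
    upper half-plane. This is why the contour turns counterclockwise. *)
Lemma Re_phase (w : R[i]) : 0 <= complex.Im w ->
  complex.Re (- (r%:C + w) ^+ 2 / (4%:R * 'i%R * t%:C)) <= - (complex.Im (w ^+ 2) / (4 * t)).
Proof.
move=> w0.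
have -> : (4%:R * 'i%R * t%:C : R[i])^-1 = - 'i%R * ((4 * t)^-1)%:C.
  apply: mulr1_eq.
  have -> : 4%:R * 'i%R * t%:C * (- 'i%R * ((4 * t)^-1)%:C) =
      - ('i%R ^+ 2) * (4%:R * t%:C * ((4 * t)^-1)%:C) by ring.
  rewrite sqrCi opprK mul1r -(rmorph_nat (real_complex R)) -!rmorphM divff//.
  by rewrite mulf_neq0 ?gt_eqF.
rewrite -complexiE mulrA mulrNN.
have c0 : 0 < (4 * t)^-1 by rewrite invr_gt0 mulr_gt0.
rewrite ReM /= mulr0 subr0 !expr2; case: w w0 => a b /= b0.
have rb : 0 <= r * b by rewrite mulr_ge0.
nra.
Qed.

Lemma cabs_Lambda_arg (v : R[i]) (x : R) : `|x| <= 1 ->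
  cabs ((Num.sqrt r)%:C * v * x%:C / csqrt ('i%R * t%:C)) ^+ 2 <= r / t * cabs v ^+ 2.
Proof.
move=> x1; rewrite !cabsM cabsV !exprMn exprVn cabs_csqrt_it !cabs_real.
rewrite real_normK ?num_real// sqr_sqrtr//.
have : `|x| ^+ 2 <= 1 by rewrite expr_le1.
move=> x2; rewrite [leRHS]mulrAC ler_wpM2r// ?invr_ge0 ?(ltW t0)//.
by rewrite ler_piMr// mulr_ge0// exprn_ge0// cabs_ge0.
Qed.

(** With w = v^2, the squared arguments of [Lambda] are at most (r / t) |w|, so [Lambda_bound] gives
    e^{2 (r / t) |w|}, and F adds e^{B |w|}: hence c = 2 r / t + B. The constant C collects the
    prefactor, the two [Lambda] terms and A, so both constants are uniform in eps and theta. *)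
Lemma kernel_bound : exists C c, [/\ 0 <= C, 0 <= c &
  forall eps theta (v : R[i]), 0 <= complex.Im (v ^+ 2) ->
  cabs (kernel bc F t r phi eps theta v) <=
  C * expR (- eps * complex.Re (v ^+ 4) - complex.Im (v ^+ 4) / (4 * t) + c * cabs v ^+ 2)].
Proof.
have [_ [A [B [A0 B0 FAB]]]] := FA.
have [L L0 LB] := @Lambda_bound R.
pose K := cabs (8%:R * 'i%R * pi%:C * t%:C : R[i])^-1.
exists (K * (2 * L) * A), (2 * (r / t) + B); split.
- by rewrite !mulr_ge0// cabs_ge0.
- by rewrite addr_ge0// mulr_ge0// divr_ge0// ltW.
move=> eps theta v v0; rewrite /kernel.
set X := - (r%:C + v ^+ 2) ^+ 2 / _.
set a1 := _ / csqrt _; set a2 := _ / csqrt _.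
set N := cabs v ^+ 2.
have hX : expR (complex.Re X) <= expR (- (complex.Im (v ^+ 4) / (4 * t))).
  have -> : v ^+ 4 = (v ^+ 2) ^+ 2 by rewrite -exprM.
  by rewrite ler_expR; exact: Re_phase.
have h1 : cabs (Lambda a1) <= L * expR (2 * (r / t) * N).
  apply: (le_trans (LB _)); rewrite ler_wpM2l// ler_expR -mulrA ler_wpM2l//.
  by apply: cabs_Lambda_arg; exact: cos_max.
have h2 : cabs (Lambda a2) <= L * expR (2 * (r / t) * N).
  apply: (le_trans (LB _)); rewrite ler_wpM2l// ler_expR -mulrA ler_wpM2l//.
  rewrite /a2 mulNr cabsN.
  by apply: cabs_Lambda_arg; exact: sin_max.
have hL : cabs (Lambda a1 + bc_sign R bc * Lambda a2) <= 2 * L * expR (2 * (r / t) * N).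
  have bs : cabs (bc_sign R bc) = 1 by case: bc; rewrite /= ?cabsN cabs1.
  apply: (le_trans (cabsD _ _)); rewrite cabsM bs mul1r; lra.
have hF : cabs (F (v ^+ 2 * (cos theta)%:C, v ^+ 2 * (sin theta)%:C)) <= A * expR (B * N).
  have := FAB (v ^+ 2 * (cos theta)%:C, v ^+ 2 * (sin theta)%:C).
  rewrite /cabs2 /= !cabsM !cabs_real !exprMn !real_normK ?num_real// -mulrDr cos2Dsin2 mulr1.
  by rewrite -expr2 sqrtr_sqr ger0_norm// exprn_ge0// cabs_ge0.
have -> : K * (2 * L) * A * expR (- eps * complex.Re (v ^+ 4) - complex.Im (v ^+ 4) / (4 * t)
    + (2 * (r / t) + B) * N) = expR (- eps * complex.Re (v ^+ 4)) *
   (expR (- (complex.Im (v ^+ 4) / (4 * t))) * K * (2 * L * expR (2 * (r / t) * N))) *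
   (A * expR (B * N)).
  have expand (a b p q n : R) :
      expR (a - b + (p + q) * n) = expR a * expR (- b) * (expR (p * n) * expR (q * n)).
    by rewrite mulrDl !expRD.
  rewrite expand; move: (expR _) (expR _) (expR _) (expR _) => e1 e2 e3 e4; ring.
rewrite !cabsM !cabs_cexp -/K.
have -> : complex.Re (- eps%:C * v ^+ 4) = - eps * complex.Re (v ^+ 4).
  by rewrite mulNr ReN ReM /= mul0r subr0 mulNr.
have K0 : 0 <= K by exact: cabs_ge0.
apply: ler_pM => //; last 1 first.
- apply: ler_wpM2l => //; apply: ler_pM => //.
  + by rewrite mulr_ge0.
  + exact: cabs_ge0.
  + exact: ler_wpM2r.
- by rewrite !mulr_ge0// cabs_ge0.
- exact: cabs_ge0.
Qed.

End kernel_bound.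

(** * The polar angle on the slit plane *)

Section angles.
Context {R : realType}.
Implicit Types (r q d : R) (y : R * R).

Lemma cos_eq1_small d : cos d = 1 -> - (2 * pi) < d < 2 * pi -> d = 0.
Proof.
move=> cd /andP[d1 d2].
have : sin (d / 2) = 0.
  apply/eqP; rewrite -sqrf_eq0; apply/eqP.
  have := cd; rewrite {1}(splitr d) cosD -!expr2 cos2sin2; lra.
have [d0|d0|//] := ltgtP d 0.
- have /sin_gt0_pi : 0 < - (d / 2) < pi by apply/andP; split; lra.
  by rewrite sinN; lra.
- have /sin_gt0_pi : 0 < d / 2 < pi by apply/andP; split; lra.
  by lra.
Qed.

Lemma prad_polar r q : 0 <= r -> prad (r * cos q, r * sin q) = r.
Proof.
by move=> r0; rewrite /prad /= !exprMn -mulrDr cos2Dsin2 mulr1 sqrtr_sqr ger0_norm.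
Qed.

(** Two admissible angles of one point differ by less than 2 pi, and their difference has cosine
    1. *)
Lemma pangle_polar r q : 0 < r -> - (pi / 2) < q < 3%:R * pi / 2 ->
  pangle (r * cos q, r * sin q) = q.
Proof.
move=> r0 /andP[q1 q2]; apply: xget_unique => /=.
  by split; [rewrite q1 q2|rewrite prad_polar// ltW].
move=> q' [/andP[q1' q2']]; rewrite prad_polar ?ltW// => -[e1 e2].
have c : cos q = cos q' by apply: (mulfI (lt0r_neq0 r0)).
have s : sin q = sin q' by apply: (mulfI (lt0r_neq0 r0)).
have : q' - q = 0.
  apply: cos_eq1_small; first by rewrite cosB c s -!expr2 cos2Dsin2.
  by apply/andP; split; lra.
lra.
Qed.

Lemma Omega_polar r q : 0 < r -> - (pi / 2) < q < 3%:R * pi / 2 ->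
  Omega (r * cos q, r * sin q).
Proof.
move=> r0 /andP[q1 q2] [/= e1 e2].
have c0 : cos q = 0 by apply: (mulfI (lt0r_neq0 r0)); rewrite mulr0.
have s0 : sin q <= 0 by rewrite -(pmulr_rle0 _ r0).
have s1 : sin q = - 1.
  have := cos2Dsin2 q; rewrite c0 expr0n /= add0r => /eqP.
  rewrite sqrf_eq1 => /orP[|] /eqP // e; move: s0; rewrite e; lra.
have : q + pi / 2 = 0.
  apply: cos_eq1_small; last by apply/andP; split; lra.
  by rewrite cosDpihalf s1 opprK.
lra.
Qed.

(* [powR] rather than an inverse: its measurability is in the library. *)
Definition half_tan_angle y : R := pi / 2 - 2 * atan (y.1 * (prad y + y.2) `^ (-1)).

(** y_1 / (|y| + y_2) is the tangent of half the angle pi/2 - q from the positive x_2-axis to y. Its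
    denominator vanishes exactly on the slit, so this is the branch of the angle required on Omega,
    in a measurable form. *)
Lemma half_tan_angleP y : Omega y ->
  [/\ 0 < prad y, - (pi / 2) < half_tan_angle y < 3%:R * pi / 2 &
    y = (prad y * cos (half_tan_angle y), prad y * sin (half_tan_angle y))].
Proof.
move=> Oy; set q := half_tan_angle y.
have [y2 r2] : y.1 ^+ 2 + y.2 ^+ 2 = prad y ^+ 2 /\ 0 <= prad y.
  by rewrite sqr_sqrtr ?addr_ge0 ?sqr_ge0// sqrtr_ge0.
set r := prad y in y2 r2.
have S0 : 0 < r + y.2.
  have [h|h] := ltP 0 y.2; first lra.
  have y10 : y.1 != 0 by apply/eqP => e; apply: Oy.
  have : 0 < y.1 ^+ 2 by rewrite exprn_even_gt0.
  nra.
have r0 : 0 < r.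
  rewrite lt_neqAle r2 andbT eq_sym; apply/eqP => e.
  move: y2 S0; rewrite e add0r expr0n /= => h1 h2; have := sqr_ge0 y.1; nra.
have qr : - (pi / 2) < q < 3%:R * pi / 2.
  rewrite /q /half_tan_angle; set T := atan _.
  have : - (pi / 2) < T by exact: atan_gtNpi2.
  have : T < pi / 2 by exact: atan_ltpi2.
  by move=> h1 h2; apply/andP; split; lra.
split => //.
have S : (r + y.2) ^+ 2 + y.1 ^+ 2 = 2 * r * (r + y.2).
  by rewrite (_ : y.1 ^+ 2 = r ^+ 2 - y.2 ^+ 2); [ring|lra].
set k := y.1 / (r + y.2); set T := atan k.
have cT0 : cos T != 0.
  by rewrite cos_atan invr_neq0// gt_eqF// sqrtr_gt0 ltr_wpDr// sqr_ge0.
have sT : sin T = k * cos T by rewrite -(atanK k) /tan divfK.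
have c2T : cos T ^+ 2 = (r + y.2) / (2 * r).
  rewrite cos_atan exprVn sqr_sqrtr ?addr_ge0 ?sqr_ge0//.
  have -> : 1 + k ^+ 2 = ((r + y.2) ^+ 2 + y.1 ^+ 2) / (r + y.2) ^+ 2.
    by rewrite /k; field; rewrite gt_eqF.
  by rewrite S; field; rewrite !gt_eqF.
have cq : cos q = 2 * k * cos T ^+ 2.
  rewrite /q /half_tan_angle -/r powR_inv1 ?(ltW S0)// -/k -/T cosB cos_pihalf sin_pihalf mul0r add0r mul1r.
  by rewrite mulr_natl mulr2n sinD sT; ring.
have sq : sin q = 2 * cos T ^+ 2 - 1.
  rewrite /q /half_tan_angle -/r powR_inv1 ?(ltW S0)// -/k -/T sinB cos_pihalf sin_pihalf mul0r subr0 mul1r.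
  by rewrite mulr_natl mulr2n cosD -!expr2 sin2cos2; ring.
rewrite -/r cq sq c2T [LHS]surjective_pairing; congr pair.
- by rewrite /k; field; rewrite !gt_eqF.
- by field; rewrite gt_eqF.
Qed.

Lemma measurable_prad : measurable_fun setT (@prad R).
Proof.
apply: (measurableT_comp (f := @Num.sqrt R)).
  by apply: continuous_measurable_fun => x; exact: sqrt_continuous.
by apply: measurable_funD; apply: measurable_funX;
  [exact: measurable_fst|exact: measurable_snd].
Qed.

Lemma measurable_half_tan_angle : measurable_fun setT half_tan_angle.
Proof.
apply: measurable_funB => //; apply: measurable_funM => //.
apply: (measurableT_comp (f := @atan R)).
  by apply: continuous_measurable_fun => x; exact: continuous_atan.
apply: measurable_funM; first exact: measurable_fst.
apply: (measurableT_comp (f := @powR R ^~ (-1))); first exact: measurable_powR.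
by apply: measurable_funD; [exact: measurable_prad|exact: measurable_snd].
Qed.

End angles.

Section decay.
Context {R : realType}.

(* The right-hand side f(b) solves f'' = - 4 f, so on [0, alpha] it is a combination
   of f(0) = eps and f(alpha) with nonnegative coefficients of sum at least 1. *)
Lemma rotated_decay_ge (eps s alpha b m : R) : 0 <= b <= alpha -> 0 < alpha < pi / 2 ->
  0 <= m -> m <= eps -> m <= eps * cos (2 * alpha) + s * sin (2 * alpha) ->
  m <= eps * cos (2 * b) + s * sin (2 * b).
Proof.
move=> /andP[b0 ba] /andP[a0 a1] m0 me ma.
have sa : 0 < sin (2 * alpha) by apply: sin_gt0_pi; lra.
have s1 : 0 <= sin (2 * (alpha - b)) by apply: sin_ge0_pi; lra.
have s2 : 0 <= sin (2 * b) by apply: sin_ge0_pi; lra.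
have := cos_max (2 * b); have := cos_max (2 * (alpha - b)).
rewrite !ler_norml => /andP[_ c1] /andP[_ c2].
have e1 : sin (2 * alpha) = sin (2 * (alpha - b)) * cos (2 * b) + cos (2 * (alpha - b)) * sin (2 * b).
  by rewrite -sinD; congr sin; ring.
have e2 : sin (2 * (alpha - b)) = sin (2 * alpha) * cos (2 * b) - cos (2 * alpha) * sin (2 * b).
  by rewrite -sinB; congr sin; ring.
have e3 : sin (2 * alpha) * (eps * cos (2 * b) + s * sin (2 * b)) =
    sin (2 * (alpha - b)) * eps + sin (2 * b) * (eps * cos (2 * alpha) + s * sin (2 * alpha)).
  by rewrite e2; ring.
rewrite -(ler_pM2l sa) e3.
apply: (@le_trans _ _ ((sin (2 * (alpha - b)) + sin (2 * b)) * m)).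
  by rewrite ler_wpM2r// e1 lerD// ?ler_piMr// ler_piMl.
by rewrite mulrDl lerD// ler_wpM2l.
Qed.

(** Completing the square in - k x^2 + (c + n) x. *)
Lemma gauss_le_exp (k c n x : R) : 0 < k ->
  expR (- k * x ^+ 2 + c * x) <= expR ((c + n) ^+ 2 / (4 * k)) * expR (- (n * x)).
Proof.
move=> k0; rewrite -expRD ler_expR.
have -> : (c + n) ^+ 2 / (4 * k) + - (n * x) =
  - k * x ^+ 2 + c * x + k * (x - (c + n) / (2 * k)) ^+ 2 by field; rewrite gt_eqF.
by rewrite lerDl mulr_ge0// ?(ltW k0)// sqr_ge0.
Qed.

End decay.

(** * Rotation of the contour *)

Section rays.
Context {R : realType}.
Notation mu := (@lebesgue_measure R).
Variables (bc : BC) (F : R[i] * R[i] -> R[i]) (t : R) (x : R * R).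
Hypotheses (FA : A1 F) (t0 : 0 < t).

Notation K := (kernel bc F t (prad x) (pangle x)).

Let r0 : 0 <= prad x. Proof. exact: sqrtr_ge0. Qed.

(** The ray arg w = b seen in the variable v, parametrized by rho = |w|; hence the square root and
    the half angle. *)
Definition ray (b rho : R) : R[i] := (Num.sqrt rho)%:C * cexp ((b / 2) *i).

(** The polar Jacobian is included; the constant e^{2ib} coming from w dw is kept outside. *)
Definition ray_fun (eps b : R) (p : R * R) : R[i] := p.1%:C * K eps p.2 (ray b p.1).

Lemma cexp_im_sqr (b : R) : cexp ((b / 2) *i) ^+ 2 = cexp (b *i).
Proof.
rewrite expr2 -cexpD; congr cexp; apply: complex_ext; rewrite ?ReD ?ImD /=; lra.
Qed.

Lemma ray_sqr b rho : 0 <= rho -> ray b rho ^+ 2 = rho%:C * cexp (b *i).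
Proof. by move=> h; rewrite exprMn -rmorphXn sqr_sqrtr// cexp_im_sqr. Qed.

Lemma Re_ray_gt0 b rho : 0 < rho -> - pi < b < pi -> 0 < complex.Re (ray b rho).
Proof.
move=> h /andP[b1 b2]; rewrite /ray ReM /= mul0r subr0 expR0 mul1r.
by rewrite mulr_gt0 ?sqrtr_gt0// cos_gt0_pihalf//; apply/andP; split; lra.
Qed.

Lemma ccont_ray_fun eps b : ccont (ray_fun eps b).
Proof.
move=> p; apply: ccont_atM.
  by apply: ccont_at_real; exact: cvg_fst.
apply: (ccont_kernel _ t _ _ FA _ (f := fun p => ray b p.1)); first exact: cvg_snd.
apply: ccont_atM; last exact: ccont_at_cst.
by apply: ccont_at_real; apply: (cvg_comp _ _ cvg_fst); exact: sqrt_continuous.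
Qed.

Lemma measurable_ray_fun eps b :
  measurable_fun setT (fun p => complex.Re (ray_fun eps b p)) /\
  measurable_fun setT (fun p => complex.Im (ray_fun eps b p)).
Proof.
by split; apply: continuous_measurable_fun2 => p; have [] := ccont_ray_fun eps b p.
Qed.

Lemma kernel_ray_bound : exists C c, [/\ 0 <= C, 0 <= c &
  forall eps b theta rho, 0 <= rho -> 0 <= b <= pi / 2 ->
  cabs (K eps theta (ray b rho)) <=
  C * expR (- (eps * cos (2 * b) + sin (2 * b) / (4 * t)) * rho ^+ 2 + c * rho)].
Proof.
have [C [c [C0 c0 Kb]]] := @kernel_bound R bc F t (prad x) (pangle x) FA t0 r0.
exists C, c; split => // eps b theta rho rho0 /andP[b0 b1].
have v2 := ray_sqr b rho0.
have v4 : ray b rho ^+ 4 = (rho ^+ 2)%:C * cexp ((2 * b) *i).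
  have -> : ray b rho ^+ 4 = (ray b rho ^+ 2) ^+ 2 by rewrite -exprM.
  rewrite v2 exprMn -rmorphXn; congr (_ * _).
  by rewrite -(cexp_im_sqr (2 * b)) [2 * b / 2]mulrAC divff// mul1r.
have i0 : 0 <= complex.Im (ray b rho ^+ 2).
  rewrite v2 ImM /= mul0r addr0 expR0 mul1r mulr_ge0// sin_ge0_pi//.
  by apply/andP; split; lra.
apply: (le_trans (Kb eps theta _ i0)); rewrite ler_wpM2l// ler_expR.
rewrite v4 ReM ImM /= !mul0r subr0 addr0 expR0 !mul1r -cabsX v2 cabsM cabs_real.
rewrite cabs_cexp /= expR0 mulr1 ger0_norm//.
by rewrite le_eqVlt; apply/orP; left; apply/eqP; ring.
Qed.

Lemma expR_geX n (y : R) : 0 <= y -> y ^+ n <= expR (n%:R * y).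
Proof.
move=> y0; rewrite expRM_natl; apply: lerXn2r; rewrite ?nnegrE ?expR_ge0//.
by have := expR_ge1Dx y; lra.
Qed.

(** A Gaussian rate m absorbs the linear exponent c rho, the power rho^n <= e^{n rho} and the
    required e^{-rho}. The surplus d of the rate is left to pay for a factor e^{d rho^2}. M is
    uniform in eps, b, d and theta. *)
Lemma kernel_ray_decay n (m : R) : 0 < m -> exists2 M, 0 <= M &
  forall eps b d theta rho, 0 <= rho -> 0 <= b <= pi / 2 ->
  m + d <= eps * cos (2 * b) + sin (2 * b) / (4 * t) ->
  rho ^+ n * (expR (d * rho ^+ 2) * cabs (K eps theta (ray b rho))) <= M * expR (- rho).
Proof.
move=> m0; have [C [c [C0 c0 Kb]]] := kernel_ray_bound.
pose k := c + n%:R.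
exists (C * expR ((k + 1) ^+ 2 / (4 * m))); first by rewrite mulr_ge0.
move=> eps b d theta rho rho0 bb md.
have h1 := Kb eps b theta rho rho0 bb.
set X := cabs _ in h1 *; set kap := _ + _ / _ in h1 md.
apply: (@le_trans _ _ (C * (expR (n%:R * rho) * (expR (d * rho ^+ 2) * expR (- kap * rho ^+ 2 + c * rho))))).
  rewrite [leRHS]mulrCA; apply: ler_pM.
  - exact: exprn_ge0.
  - by rewrite mulr_ge0// cabs_ge0.
  - exact: expR_geX.
  - by rewrite [leRHS]mulrCA ler_wpM2l.
rewrite -mulrA ler_wpM2l// -!expRD.
have h2 := gauss_le_exp k 1 rho m0; rewrite mul1r -expRD in h2.
apply: le_trans h2; rewrite ler_expR /k.
have := sqr_ge0 rho; nra.
Qed.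

Lemma ray_fun_decay (eps b m : R) : 0 < m -> 0 <= b <= pi / 2 ->
  m <= eps * cos (2 * b) + sin (2 * b) / (4 * t) ->
  exists2 M, 0 <= M & forall p, 0 <= p.1 ->
    cabs (ray_fun eps b p) <= M * expR (- `|p.1|).
Proof.
move=> m0 bb mk; have [M M0 H] := kernel_ray_decay 1 m0.
exists M => // -[rho theta] /= rho0.
have := H eps b 0 theta rho rho0 bb; rewrite addr0 => /(_ mk).
by rewrite mul0r expR0 mul1r /ray_fun cabsM cabs_real expr1 !ger0_norm.
Qed.

(** With rho = e^u, the polar Jacobian and drho = e^u du contribute a factor rho each, and rho^2 =
    e^{-2ib} (e^{u+ib})^2. The right-hand side is thus e^{-2ib} times the value at u + ib of the
    entire function e^{2z} K(e^{z/2}). *)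
Lemma ray_fun_exp eps b theta u :
  (expR u)%:C * ray_fun eps b (expR u, theta) =
  cexp (- b *i) ^+ 2 * (cexp (u +i* b) ^+ 2 * K eps theta (cexp ((u / 2) +i* (b / 2)))).
Proof.
have e1 : cexp (u +i* b) = (expR u)%:C * cexp (b *i).
  by rewrite -cexp_real -cexpD; congr cexp; apply: complex_ext; rewrite ?ReD ?ImD /=; lra.
have e2 : cexp ((u / 2) +i* (b / 2)) = ray b (expR u).
  rewrite /ray (_ : Num.sqrt _ = expR (u / 2)).
    by rewrite -cexp_real -cexpD; congr cexp; apply: complex_ext; rewrite ?ReD ?ImD /=; lra.
  by rewrite [in LHS](splitr u) expRD -expr2 sqrtr_sqr ger0_norm.
have e3 : cexp (- b *i) * cexp (b *i) = 1.
  rewrite -cexpD (_ : _ + _ = 0) ?cexp0//.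
  by apply: complex_ext; rewrite ?ReD ?ImD /=; lra.
rewrite e1 e2 /ray_fun /= [in RHS]exprMn; set k := K _ _ _.
transitivity ((cexp (- b *i) * cexp (b *i)) ^+ 2 * ((expR u)%:C ^+ 2 * k)).
  by rewrite e3 expr1n mul1r; ring.
ring.
Qed.

Let pos : set R := `]0, +oo[%classic.

Lemma cintegrable_pos_ray_fun eps b m theta : 0 < m -> 0 <= b <= pi / 2 ->
  m <= eps * cos (2 * b) + sin (2 * b) / (4 * t) ->
  cintegrable mu pos (fun rho => ray_fun eps b (rho, theta)).
Proof.
move=> m0 bb mk; have [M M0 H] := ray_fun_decay m0 bb mk.
have [m1 m2] := measurable_ray_fun eps b.
apply: (@cintegrable_le _ (measurableTypeR R) R mu pos (measurable_itv _) _ (fun rho => M * expR (- `|rho|))).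
- by apply: measurable_funTS; exact: (measurable_fun_pair1 theta m1).
- by apply: measurable_funTS; exact: (measurable_fun_pair1 theta m2).
- have iK := @integrableZl _ (measurableTypeR R) R mu setT measurableT M _ (@integrable_expRN_abs R).
  by apply: integrableS iK => //; exact: measurable_itv.
- by move=> rho; rewrite /pos /= in_itv/= andbT => /ltW rho0; exact: (H (rho, theta)).
Qed.

Lemma cintegral_pos_ray_fun eps b theta :
  cintegral mu pos (fun rho => ray_fun eps b (rho, theta)) =
  cintegral mu setT (fun u => (expR u)%:C * ray_fun eps b (expR u, theta)).
Proof.
have [m1 m2] := measurable_ray_fun eps b.
have n1 := measurable_fun_pair1 theta m1; have n2 := measurable_fun_pair1 theta m2.
move: (ray_fun eps b) n1 n2 => f n1 n2.
by apply: complex_ext => /=; rewrite /Rintegral integral_exp//; congr fine;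
  apply: eq_integral => u _; rewrite ?ReM ?ImM /= !mul0r ?subr0 ?addr0 mulrC.
Qed.

(* In the logarithmic variable [u] the sector between the two rays is a strip. *)
Lemma ray_rotation eps alpha theta : 0 < eps -> 0 < alpha < pi / 2 ->
  0 < eps * cos (2 * alpha) + sin (2 * alpha) / (4 * t) ->
  cintegral mu pos (fun rho => ray_fun eps 0 (rho, theta)) =
  cexp ((2%:R * alpha) *i) * cintegral mu pos (fun rho => ray_fun eps alpha (rho, theta)).
Proof.
move=> eps0 aa ka; have /andP[a0 a1] := aa.
set kap := _ + _ in ka.
(* The decay rates on the bounding rays b = 0 and b = alpha are eps and [kap]; their minimum bounds
   the rate in the whole sector. *)
pose m := Num.min eps kap.
have m0 : 0 < m by rewrite lt_min eps0 ka.
pose g (z : R[i]) := cexp z ^+ 2 * K eps theta (cexp (2^-1%:C * z)).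
have gd z : cdiff g z.
  apply: cdiffM; first exact: (cdiffX 2 (cdiff_cexp z)).
  apply: (cdiff_comp (g := fun z => cexp (2^-1%:C * z))); last exact: cdiff_kernel.
  apply: (cdiff_comp (f := @cexp R)); last exact: cdiff_cexp.
  by apply: cdiffZ; exact: cdiff_id.
have gE b u : g (u +i* b) = cexp (u +i* b) ^+ 2 * K eps theta (cexp ((u / 2) +i* (b / 2))).
  congr (_ * K _ _ (cexp _)).
  by apply: complex_ext; rewrite ?ReM ?ImM /= !mul0r ?subr0 ?addr0 mulrC.
have km b : 0 <= b <= alpha -> m <= eps * cos (2 * b) + sin (2 * b) / (4 * t).
  move=> bb; rewrite [sin (2 * b) / _]mulrC.
  apply: (rotated_decay_ge bb aa (ltW m0)).
  - by rewrite ge_min lexx.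
  - by rewrite [_ * sin _]mulrC ge_min lexx orbT.
(* The function to bound is rho^2 |K| with rho = e^u. The power 1 gives rho^2 |K| <= M1 rho, used
   for u < 0; the power 3 gives rho^2 |K| <= M3 / rho, used for u >= 0. *)
have [M1 M10 H1] := kernel_ray_decay 1 m0.
have [M3 M30 H3] := kernel_ray_decay 3 m0.
have gC u b : 0 <= b <= alpha -> cabs (g (u +i* b)) <= (M1 + M3) * expR (- `|u|).
  move=> bb; have kb := km _ bb.
  have bb' : 0 <= b <= pi / 2 by move/andP: bb => [? ?]; apply/andP; split; lra.
  have -> : cabs (g (u +i* b)) = expR u ^+ 2 * cabs (K eps theta (ray b (expR u))).
    have := ray_fun_exp eps b theta u; rewrite -gE => /(congr1 (@cabs R)).
    rewrite [cabs (cexp _ ^+ 2 * _)]cabsM cabsX cabs_cexp /= ?oppr0 expR0 expr1n mul1r => <-.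
    by rewrite /ray_fun /= mulrA -rmorphM cabsM cabs_real ger0_norm ?mulr_ge0 ?expR_ge0.
  have e0 := expR_gt0 u.
  have := H1 eps b 0 theta _ (ltW e0) bb'; have := H3 eps b 0 theta _ (ltW e0) bb'.
  rewrite addr0 !mul0r !expR0 !mul1r => /(_ kb) h3 /(_ kb) h1.
  set k := cabs _ in h1 h3 *; have k0 : 0 <= k by exact: cabs_ge0.
  have el1 : expR (- expR u) <= 1 by rewrite -expR0 ler_expR oppr_le0 ltW.
  have [u0|u0] := leP 0 u.
    rewrite ger0_norm// expRN -(ler_pM2l e0).
    have -> : expR u * ((M1 + M3) * (expR u)^-1) = M1 + M3 by field; rewrite gt_eqF.
    rewrite mulrA -exprS; nra.
  rewrite ltr0_norm// opprK expr2 -mulrA mulrC ler_wpM2r ?(ltW e0)//.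
  by rewrite expr1 in h1; nra.
have := contour_shift gd (ltW a0) (addr_ge0 M10 M30) gC.
rewrite !cintegral_pos_ray_fun.
have i2 : cintegrable mu setT (fun u => g (u +i* alpha)).
  have cg := ccont_hline gd alpha.
  apply: (@cintegrable_le _ (measurableTypeR R) R mu setT measurableT _ (fun u => (M1 + M3) * expR (- `|u|))).
  - by apply: continuous_measurable_fun => u; have [] := cg u.
  - by apply: continuous_measurable_fun => u; have [] := cg u.
  - by apply: eq_integrable (@integrableZl _ (measurableTypeR R) R mu setT measurableT (M1 + M3) _ (@integrable_expRN_abs R)).
  - by move=> u _; apply: gC; rewrite lexx (ltW a0).
have -> : cintegral mu setT (fun u => (expR u)%:C * ray_fun eps 0 (expR u, theta)) =
    cintegral mu setT (fun u => g (u +i* 0)).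
  apply: eq_cintegral => u _; rewrite ray_fun_exp -gE.
  by rewrite oppr0 cexp0 expr1n mul1r.
have -> : cintegral mu setT (fun u => (expR u)%:C * ray_fun eps alpha (expR u, theta)) =
    cexp (- alpha *i) ^+ 2 * cintegral mu setT (fun u => g (u +i* alpha)).
  rewrite -cintegralZ//; apply: eq_cintegral => u _.
  by rewrite ray_fun_exp -gE.
move=> ->; rewrite mulrA expr2 -!cexpD (_ : _ + _ = 0) ?cexp0 ?mul1r//.
by apply: complex_ext; rewrite ?ReD ?ImD /=; lra.
Qed.

End rays.

(** * The two integrals in polar coordinates *)

Section polar_form.
Context {R : realType}.
Notation mu := (@lebesgue_measure R).
Variables (bc : BC) (F : R[i] * R[i] -> R[i]) (t : R) (x : R * R).
Hypotheses (FA : A1 F) (t0 : 0 < t).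

Notation K := (kernel bc F t (prad x) (pangle x)).
Notation ray_fun := (ray_fun bc F t x).

Lemma measurable_Omega : measurable (@Omega R).
Proof.
rewrite (_ : @Omega R = ~` ([set 0] `*` `]-oo, 0])).
  by apply: measurableC; apply: measurableX.
by apply/seteqP; split=> -[a b] /= H [/= h1 h2]; apply: H; split => //=;
  move: h2; rewrite in_itv.
Qed.

Lemma reg_integrand_polar eps rho theta : 0 < rho ->
  - (pi / 2) < theta < 3%:R * pi / 2 ->
  reg_integrand bc F t x eps (rho * cos theta, rho * sin theta) = K eps theta (ray 0 rho).
Proof.
move=> rho0 th; have v2 : ray 0 rho ^+ 2 = rho%:C.
  rewrite ray_sqr ?ltW// (_ : 0 *i = 0 :> R[i]) ?cexp0 ?mulr1//.
rewrite kernel_Gfun ?sqrtr_ge0//; last first.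
  by apply: Re_ray_gt0 => //; rewrite oppr_lt0 pi_gt0.
have -> : ray 0 rho ^+ 4 = (rho ^+ 2)%:C.
  by rewrite (_ : ray 0 rho ^+ 4 = (ray 0 rho ^+ 2) ^+ 2) -?exprM// exprM v2 rmorphXn.
rewrite /reg_integrand /G prad_polar ?(ltW rho0)// pangle_polar// v2 -!rmorphM.
by rewrite -rmorphN -rmorphM cexp_real.
Qed.

Lemma rot_integrandE alpha p : 0 < alpha < pi / 2 -> rot_domain p ->
  rot_integrand bc F t x alpha p = ray_fun 0 alpha p.
Proof.
move=> /andP[a0 a1] [rho0 _]; rewrite /ray_fun kernel_Gfun ?sqrtr_ge0//; last first.
  by apply: Re_ray_gt0 => //; apply/andP; split; lra.
rewrite oppr0 mul0r cexp0 mul1r ray_sqr ?ltW// /rot_integrand.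
by rewrite [RHS]mulrC.
Qed.

(** A measurable stand-in for the regularized integrand: the chosen angle is replaced by the
    explicit one, and the two functions agree on Omega. *)
Let regM eps y := K eps (half_tan_angle y) (ray 0 (prad y)).

Let reg_regM eps y : Omega y -> reg_integrand bc F t x eps y = regM eps y.
Proof.
by move=> /half_tan_angleP[h1 h2 {1}->]; exact: reg_integrand_polar.
Qed.

Let measurable_regM eps : measurable_fun setT (fun y => complex.Re (regM eps y)) /\
  measurable_fun setT (fun y => complex.Im (regM eps y)).
Proof.
have c : ccont (fun p : R * R => K eps p.2 (ray 0 p.1)).
  move=> p; apply: (ccont_kernel _ t _ _ FA _ (f := fun p => ray 0 p.1)); first exact: cvg_snd.
  apply: ccont_atM; last exact: ccont_at_cst.
  by apply: ccont_at_real; apply: (cvg_comp _ _ cvg_fst); exact: sqrt_continuous.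
have mp : measurable_fun setT (fun y : R * R => (prad y, half_tan_angle y)).
  by apply: measurable_fun_pair; [exact: measurable_prad|exact: measurable_half_tan_angle].
split.
- apply: (measurableT_comp (f := fun p : R * R => complex.Re (K eps p.2 (ray 0 p.1))) _ mp).
  by apply: continuous_measurable_fun2 => p; have [] := c p.
- apply: (measurableT_comp (f := fun p : R * R => complex.Im (K eps p.2 (ray 0 p.1))) _ mp).
  by apply: continuous_measurable_fun2 => p; have [] := c p.
Qed.

(** [pt] stands for the real or the imaginary part; of these, only homogeneity under real factors
    enters, to extract the Jacobian. *)
Let reg_part (pt : R[i] -> R) eps : (forall a z, pt (a%:C * z) = a * pt z) ->
  measurable_fun setT (fun y => pt (regM eps y)) ->
  (\int[@leb2 R]_(y in @Omega R) (pt (reg_integrand bc F t x eps y))%:E =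
   \int[@leb2 R]_(p in @rot_domain R) (pt (ray_fun eps 0 p))%:E)%E /\
  ((@leb2 R).-integrable (@rot_domain R) (EFin \o (fun p => pt (ray_fun eps 0 p))) ->
   (@leb2 R).-integrable (@Omega R) (EFin \o (fun y => pt (reg_integrand bc F t x eps y)))).
Proof.
move=> ptM mpt; pose g := (fun y => pt (regM eps y)) \_ (@Omega R).
have mg : measurable_fun setT g.
  apply/(measurable_restrictT _ _).1; first exact: measurable_Omega.
  exact: measurable_funTS.
have gpolar p : rot_domain p -> g (p.1 * cos p.2, p.1 * sin p.2) * p.1 = pt (ray_fun eps 0 p).
  move=> [p0 p1]; have Op := Omega_polar p0 p1.
  rewrite /g patchE ifT ?inE// -reg_regM// reg_integrand_polar//.
  by rewrite /ray_fun ptM mulrC.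
have gE y : y \in @Omega R -> (pt (reg_integrand bc F t x eps y))%:E = (EFin \o (fun y => pt (regM eps y))) y.
  by rewrite inE => Oy; rewrite reg_regM.
split.
- transitivity (\int[@leb2 R]_(y in @Omega R) (EFin \o (fun y => pt (regM eps y))) y)%E.
    by apply: eq_integral => y yO; rewrite gE.
  rewrite integral_mkcond restrict_EFin integral_polar_rot//.
  by apply: eq_integral => p; rewrite inE => /gpolar ->.
- move=> ri; have : (@leb2 R).-integrable setT (EFin \o g).
    apply: integrable_polar_rot => //.
    apply: eq_integrable ri; first exact: measurable_rot_domain.
    by move=> p; rewrite inE => /gpolar ->.
  rewrite /g -restrict_EFin => gi.
  have : (@leb2 R).-integrable (setT `&` @Omega R) (EFin \o (fun y => pt (regM eps y))).
    by apply/integrable_restrict => //; exact: measurable_Omega.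
  rewrite setTI; apply: eq_integrable; first exact: measurable_Omega.
  by move=> y Oy; rewrite -gE.
Qed.

Let Re_real a (z : R[i]) : complex.Re (a%:C * z) = a * complex.Re z.
Proof. by rewrite ReM /= mul0r subr0. Qed.

Let Im_real a (z : R[i]) : complex.Im (a%:C * z) = a * complex.Im z.
Proof. by rewrite ImM /= mul0r addr0. Qed.

Lemma cintegral_reg eps :
  cintegral (@leb2 R) (@Omega R) (reg_integrand bc F t x eps) =
  cintegral (@leb2 R) (@rot_domain R) (ray_fun eps 0).
Proof.
have [m1 m2] := measurable_regM eps.
by congr (_ +i* _); congr fine; [have [] := reg_part Re_real m1|have [] := reg_part Im_real m2].
Qed.

Lemma cintegrable_reg eps :
  cintegrable (@leb2 R) (@rot_domain R) (ray_fun eps 0) ->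
  cintegrable (@leb2 R) (@Omega R) (reg_integrand bc F t x eps).
Proof.
move=> [i1 i2]; have [m1 m2] := measurable_regM eps; split.
- by have [_] := reg_part Re_real m1; apply.
- by have [_] := reg_part Im_real m2; apply.
Qed.

Lemma cintegrable_ray_fun eps b m : 0 < m -> 0 <= b <= pi / 2 ->
  m <= eps * cos (2 * b) + sin (2 * b) / (4 * t) ->
  cintegrable (@leb2 R) (@rot_domain R) (ray_fun eps b).
Proof.
move=> m0 bb mk; have [M M0 H] := @ray_fun_decay R bc F t x FA t0 eps b m m0 bb mk.
have [m1 m2] := @measurable_ray_fun R bc F t x FA eps b.
apply: (@cintegrable_le _ _ R (@leb2 R) (@rot_domain R) _ _
  (fun p => M * expR (- `|p.1|))); last 2 first.
- exact: integrable_rot_domain_expRN.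
- by move=> p [p0 _]; apply: H; exact: ltW.
- exact: measurable_rot_domain.
- exact: measurable_funTS.
- exact: measurable_funTS.
Qed.

Let pos : set R := `]0, +oo[%classic.

(** In each direction the difference of the two integrands has radial integral 0 by [ray_rotation];
    being integrable over the whole domain, it integrates to 0 by Fubini's theorem. *)
Lemma cintegral_rotation eps alpha : 0 < eps -> 0 < alpha < pi / 2 ->
  0 < eps * cos (2 * alpha) + sin (2 * alpha) / (4 * t) ->
  cintegral (@leb2 R) (@rot_domain R) (ray_fun eps 0) =
  cexp ((2%:R * alpha) *i) * cintegral (@leb2 R) (@rot_domain R) (ray_fun eps alpha).
Proof.
move=> eps0 aa ka; have /andP[a0 a1] := aa.
have b0 : 0 <= (0 : R) <= pi / 2 by apply/andP; split; lra.
have ba : 0 <= alpha <= pi / 2 by apply/andP; split; lra.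
have k0 : eps <= eps * cos (2 * 0) + sin (2 * 0) / (4 * t).
  by rewrite mulr0 cos0 sin0 mul0r mulr1 addr0.
set c := cexp _.
have i0 := cintegrable_ray_fun eps0 b0 k0.
have ia := cintegrable_ray_fun ka ba (lexx _).
have mr := @measurable_rot_domain R.
pose d p := ray_fun eps 0 p - c * ray_fun eps alpha p.
have di : cintegrable (@leb2 R) (@rot_domain R) d.
  by apply: cintegrableB => //; exact: cintegrableZ.
have mpos : measurable (pos : set (measurableTypeR R)) by exact: measurable_itv.
have dpos q : cintegrable mu pos (fun rho => d (rho, q)) /\
    cintegral mu pos (fun rho => d (rho, q)) = 0.
  have j0 := @cintegrable_pos_ray_fun R bc F t x FA t0 eps 0 eps q eps0 b0 k0.
  have ja := @cintegrable_pos_ray_fun R bc F t x FA t0 eps alpha _ q ka ba (lexx _).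
  have jca := cintegrableZ mpos c ja.
  split; first exact: cintegrableB.
  rewrite cintegralB// cintegralZ//.
  by rewrite (@ray_rotation R bc F t x FA t0 eps alpha q eps0 aa ka) subrr.
apply/eqP; rewrite -subr_eq0 -cintegralZ// -cintegralB//; last exact: cintegrableZ.
apply/eqP; apply: complex_ext => /=; rewrite /Rintegral integral_rot_domain_eq0//;
  [exact: di.1| |exact: di.2|]; move=> q _; have [[d1 d2]] := dpos q.
- move=> /(congr1 (@complex.Re R)) /= h.
  by rewrite -[LHS]fineK ?integrable_fin_num//; congr EFin.
- move=> /(congr1 (@complex.Im R)) /= h.
  by rewrite -[LHS]fineK ?integrable_fin_num//; congr EFin.
Qed.

(* |e^z - 1| <= 4 |z| e^(2|z|) with z = - eps w^2 costs a factor
   e^(2 eps |w|^2), which the decay on the rotated ray absorbs for small eps. *)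
Lemma ray_fun_eps_lipschitz alpha : 0 < alpha < pi / 2 ->
  exists2 M, 0 <= M & forall eps p, 0 < eps -> eps <= sin (2 * alpha) / (4 * t) / 4 ->
    0 <= p.1 -> cabs (ray_fun eps alpha p - ray_fun 0 alpha p) <= eps * M * expR (- `|p.1|).
Proof.
move=> /andP[a0 a1]; set s := sin _ / _.
have s0 : 0 < s.
  by rewrite divr_gt0 ?mulr_gt0// sin_gt0_pi//; apply/andP; split; lra.
have s20 : 0 < s / 2 by rewrite divr_gt0.
(* The power 3 is rho from the Jacobian times rho^2 from |z|. *)
have [M M0 H] := @kernel_ray_decay R bc F t x FA t0 3 _ s20.
exists (4 * M) => [|eps [rho theta] e0 es /= rho0]; first by rewrite mulr_ge0.
have aa : 0 <= alpha <= pi / 2 by apply/andP; split; lra.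
(* The unregularized kernel has rate s on this ray. Half of it gives the decay, and the other half
   covers the surplus 2 eps because eps <= s / 4. *)
have := H 0 alpha (2 * eps) theta rho rho0 aa.
rewrite mul0r add0r -/s => /(_ _)h; have {}h := h ltac:(lra).
rewrite /ray_fun /= [K eps _ _]kernel_eps.
set v := ray alpha rho in h *; set k := K 0 theta v in h *.
have -> : rho%:C * (cexp (- eps%:C * v ^+ 4) * k) - rho%:C * k =
    (cexp (- eps%:C * v ^+ 4) - 1) * (rho%:C * k) by ring.
have zE : cabs (- eps%:C * v ^+ 4) = eps * rho ^+ 2.
  rewrite mulNr cabsN cabsM cabs_real gtr0_norm// cabsX /v /ray cabsM cabs_cexp /=.
  rewrite expR0 mulr1 cabs_real ger0_norm ?sqrtr_ge0//.
  by congr (_ * _); rewrite -[in RHS](sqr_sqrtr rho0) -exprM.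
rewrite 2!cabsM cabs_real !ger0_norm//.
apply: (@le_trans _ _ (4 * (eps * rho ^+ 2) * expR (2 * (eps * rho ^+ 2)) * (rho * cabs k))).
  by rewrite ler_wpM2r ?mulr_ge0 ?cabs_ge0// -zE cabs_sub1_cexp.
have -> : 4 * (eps * rho ^+ 2) * expR (2 * (eps * rho ^+ 2)) * (rho * cabs k) =
    4 * eps * (rho ^+ 3 * (expR (2 * eps * rho ^+ 2) * cabs k)).
  by rewrite [2 * (eps * _)]mulrA; ring.
have -> : eps * (4 * M) * expR (- rho) = 4 * eps * (M * expR (- rho)) by ring.
by rewrite ler_wpM2l// mulr_ge0// ltW.
Qed.

End polar_form.

(** * Passage to the limit eps -> 0 *)

Lemma cvg_at_right0_linear (R : realType) (f : R -> R) (l M d : R) : 0 < d ->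
  (forall e, 0 < e -> e <= d -> `|f e - l| <= e * M) -> f e @[e --> 0^'+] --> l.
Proof.
move=> d0 fM; apply/cvgrPdist_le => e e0.
have M0 : 0 < `|M| + 1 by rewrite ltr_wpDl.
near=> y; have y0 : 0 < y by near: y; exact: nbhs_right_gt.
rewrite distrC; apply: (@le_trans _ _ (y * M)).
  by apply: fM => //; near: y; exact: nbhs_right_le.
have ye : y <= e / (`|M| + 1) by near: y; apply: nbhs_right_le; rewrite divr_gt0.
move: ye; rewrite ler_pdivlMr// => ye; apply: le_trans ye.
by rewrite ler_pM2l// (le_trans (ler_norm M))// lerDl.
Unshelve. all: by end_near. Qed.

Unset Implicit Arguments.

Theorem theorem2p2 (R : realType) (bc : BC) (F : R[i] * R[i] -> R[i])
    (t : R) (x : R * R) (alpha : R) :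
  A1 F -> 0 < t -> Omega x -> 0 < alpha < pi / 2 ->
  let Psi := cexp ((2%:R * alpha) *i) *
             cintegral (@leb2 R) (@rot_domain R) (rot_integrand bc F t x alpha) in
  [/\ cintegrable (@leb2 R) (@rot_domain R) (rot_integrand bc F t x alpha),
      (forall eps : R, 0 < eps ->
         cintegrable (@leb2 R) (@Omega R) (reg_integrand bc F t x eps)),
      (fun eps : R =>
         complex.Re (cintegral (@leb2 R) (@Omega R) (reg_integrand bc F t x eps)))
        @ (0 : R)^'+ --> (complex.Re Psi : R) &
      (fun eps : R =>
         complex.Im (cintegral (@leb2 R) (@Omega R) (reg_integrand bc F t x eps)))
        @ (0 : R)^'+ --> (complex.Im Psi : R)].
Proof.
move=> FA t0 _ aa Psi; have /andP[a0 a1] := aa.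
have mr : measurable (@rot_domain R : set (measurableTypeR R * measurableTypeR R)).
  exact: measurable_rot_domain.
have b0 : 0 <= (0 : R) <= pi / 2 by apply/andP; split; lra.
have ba : 0 <= alpha <= pi / 2 by apply/andP; split; lra.
pose s := sin (2 * alpha) / (4 * t).
have s0 : 0 < s.
  by rewrite divr_gt0 ?mulr_gt0// sin_gt0_pi//; apply/andP; split; lra.
have irot : cintegrable (@leb2 R) (@rot_domain R) (ray_fun bc F t x 0 alpha).
  by apply: (cintegrable_ray_fun bc x FA t0 s0 ba); rewrite mul0r add0r.
have rotE : {in @rot_domain R, ray_fun bc F t x 0 alpha =1 rot_integrand bc F t x alpha}.
  by move=> p; rewrite inE => rp; rewrite rot_integrandE.
have rot_int : cintegral (@leb2 R) (@rot_domain R) (rot_integrand bc F t x alpha) =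
    cintegral (@leb2 R) (@rot_domain R) (ray_fun bc F t x 0 alpha).
  by apply: eq_cintegral => p /rotE.
(* cos (2 alpha) may be negative, but it is at least -1, so eps <= s / 4 keeps the rate at or above
   3 s / 4. *)
have decay eps : 0 < eps -> eps <= s / 4 -> 0 < eps * cos (2 * alpha) + s.
  move=> e0 es; have := cos_max (2 * alpha); rewrite ler_norml => /andP[c1 _].
  have : - eps <= eps * cos (2 * alpha) by rewrite -mulrN1 ler_wpM2l// ltW.
  lra.
have [M M0 lip] := @ray_fun_eps_lipschitz R bc F t x FA t0 alpha aa.
pose N := \int[@leb2 R]_(p in @rot_domain R) expR (- `|p.1|).
have iN (c : R) : (@leb2 R).-integrable (@rot_domain R) (EFin \o (fun p => c * expR (- `|p.1|))).
  exact: integrable_rot_domain_expRN.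
have close eps : 0 < eps -> eps <= s / 4 ->
    cabs (cintegral (@leb2 R) (@Omega R) (reg_integrand bc F t x eps) - Psi) <=
    eps * (2 * (M * N)).
  move=> e0 es; have ke := decay _ e0 es.
  have ieps := cintegrable_ray_fun bc x FA t0 ke ba (lexx _).
  rewrite cintegral_reg// (cintegral_rotation bc x FA t0 e0 aa ke) /Psi.
  (* Both integrals now run over the rotated ray, and their common phase has modulus 1. *)
  rewrite rot_int -mulrBr cabsM cabs_cexp /= expR0 mul1r.
  rewrite -(cintegralB mr ieps irot).
  have := cabs_cintegral_le mr (cintegrableB mr ieps irot) (iN (eps * M)).
  move=> /(_ _)/le_trans; apply.
    by move=> p [p0 _]; apply: lip => //; exact: ltW.
  rewrite RintegralZl//; last by have := iN 1; apply: eq_integrable => // p _ /=; rewrite mul1r.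
  by rewrite le_eqVlt; apply/orP; left; apply/eqP; rewrite /N; ring.
have s40 : 0 < s / 4 by rewrite divr_gt0.
split.
- by apply: (eq_cintegrable mr _ irot) => p /rotE.
- move=> eps e0; apply: cintegrable_reg => //.
  (* On the unrotated ray the decay rate is eps itself, so every eps > 0 is admissible here. *)
  apply: (cintegrable_ray_fun bc x FA t0 e0 b0).
  by rewrite mulr0 cos0 sin0 mul0r mulr1 addr0.
- apply: (cvg_at_right0_linear s40) => e e0 es.
  by rewrite -ReN -ReD; apply: le_trans (norm_Re_le_cabs _) (close _ e0 es).
- apply: (cvg_at_right0_linear s40) => e e0 es.
  by rewrite -ImN -ImD; apply: le_trans (norm_Im_le_cabs _) (close _ e0 es).
Qed.
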